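(* There is an index occupying $O(n\log w)$ bits, in addition to the space needed to store the elements of $S$, such that for every query string $x\in\{0,1\}^w$ the index $i$ with $S[i]=x^-$ can be computed in time $O(\log(w-\log D(x,S)))$.
   Context: Let $w$ be a positive integer and let $S$ be a nonempty set of $n$ binary strings of length $w$; strings of length $w$ are identified with integers in $[0,2^w)$, so lexicographic order coincides with numeric order. The model is the word RAM with words of $w$ bits, allowing multiplication, under the full randomness assumption. The set $S$ is available as a sorted array $S[0],\dots,S[n-1]$ with constant-time access, and space bounds count only the additional bits of the index. For $x\in\{0,1\}^w$, $x^-=\max\{y\in S\mid y<x\}$ and $x^+=\min\{y\in S\mid y\ge x\}$; a predecessor query returns the index $i$ with $S[i]=x^-$ ($-1$ if none). Define $D(x,S)=\max\{x^+-x,\,x-x^-\}$, and if only one of $x^-,x^+$ exists, $D(x,S)$ is the distance from $x$ to that one. Logarithms are binary, with $\log z=1$ whenever $z<2$. *)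

(* Defs.v *)
From HB Require Import structures.
From mathcomp Require Import all_boot all_order all_algebra.
From mathcomp Require Import reals exp.

Set Implicit Arguments.
Unset Strict Implicit.
Unset Printing Implicit Defensive.

Import Order.TTheory GRing.Theory Num.Theory.

(** * Strings and predecessors *)

(* A binary string of length w is identified with the integer it denotes, so
   that lexicographic order is the order of the underlying naturals. *)
Notation word w := 'I_(2 ^ w).

Definition to_word (w k : nat) : word w :=
  Ordinal (ltn_pmod k (expn_gt0 2 w : 0 < 2 ^ w)).

Section Predecessor.
Variables (w : nat) (S : {set word w}).

(* The array S[0], ..., S[n-1]. *)
Definition sorted_array : seq (word w) :=
  sort (fun a b : word w => a <= b) (enum S).

(* x^- = max {y in S | y < x} and x^+ = min {y in S | y >= x}, when they
   exist. *)
Definition xminus (x : word w) : option (word w) :=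
  [pick y in S | (y < x) && [forall z in S, (z < x) ==> (z <= y)]].

Definition xplus (x : word w) : option (word w) :=
  [pick y in S | (x <= y) && [forall z in S, (x <= z) ==> (y <= z)]].

(* The last case occurs only for S = set0. *)
Definition distance (x : word w) : nat :=
  match xminus x, xplus x with
  | Some y, Some z => maxn (z - x) (x - y)
  | Some y, None => x - y
  | None, Some z => z - x
  | None, None => 0
  end.

(* The answer to a predecessor query as a machine word.  The answer -1 is the
   all-ones word; it cannot be confused with an index, because the index of
   x^- is at most x^- < x <= 2 ^ w - 1. *)
Definition predecessor_answer (x : word w) : word w :=
  if xminus x is Some y then to_word w (index y sorted_array)
  else to_word w (2 ^ w).-1.

End Predecessor.

(** * The word RAM *)

(* Operations on words are taken modulo 2 ^ w.  Shifting by w or more gives 0,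
   and comparisons return 0 or 1. *)
Inductive binop := Add | Sub | Mul | And | Or | Xor | Shl | Shr | Ltn | Eqn.

Definition eval_binop (w : nat) (o : binop) (a b : word w) : word w :=
  to_word w
    match o with
    | Add => a + b
    | Sub => a + (2 ^ w - b)
    | Mul => a * b
    | And => Nat.land a b
    | Or  => Nat.lor a b
    | Xor => Nat.lxor a b
    | Shl => a * 2 ^ b
    | Shr => a %/ 2 ^ b
    | Ltn => nat_of_bool (a < b)
    | Eqn => nat_of_bool (a == b)
    end.

(* Arguments are register numbers, except for the literal of Const.  Program
   texts do not depend on w: a literal is truncated to the word size of the
   machine that runs it. *)
Inductive instr :=
| Const (d k : nat)              (* d := k *)
| Op (d : nat) (o : binop) (a b : nat)
| ReadIndex (d a : nat)          (* d := the word of the index at address a *)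
| ReadS (d a : nat)              (* d := S[a] *)
| Hash (d f a : nat)             (* d := the f-th hash function at a *)
| ReadMem (d a : nat)               (* working memory *)
| WriteMem (a s : nat).

Inductive program :=
| Basic (i : instr)
| Seq (p q : program)
| If (r : nat) (p q : program)   (* tests whether r is nonzero *)
| While (r : nat) (p : program).

(* Full randomness: a family of functions from words to words, indexed by
   words, all of whose values are independent and uniform.  Evaluation takes
   one step, and the functions are not charged to the space of the index. *)
Notation hash_family w := {ffun word w * word w -> word w}.

Record state (w : nat) := State { reg : nat -> word w; mem : word w -> word w }.

(* The a-th word of a bit string that is cut into words of w bits; bits beyond
   the end read as 0. *)
Definition index_word (w : nat) (B : seq bool) (a : word w) : word w :=
  to_word w (\sum_(j < w) nth false B (a * w + j) * 2 ^ j).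

Section Execution.
Variables (w : nat) (S : {set word w}) (h : hash_family w) (B : seq bool).

Definition step (i : instr) (s : state w) : state w :=
  let r := reg s in let m := mem s in
  match i with
  | Const d k => State [eta r with d |-> to_word w k] m
  | Op d o a b => State [eta r with d |-> eval_binop o (r a) (r b)] m
  | ReadIndex d a => State [eta r with d |-> index_word B (r a)] m
  | ReadS d a =>
      State [eta r with d |-> nth (to_word w 0) (sorted_array S) (r a)] m
  | Hash d f a => State [eta r with d |-> h (r f, r a)] m
  | ReadMem d a => State [eta r with d |-> m (r a)] m
  | WriteMem a v => State r [eta m with r a |-> r v]
  end.

(* [exec p s t s']: started in s, the program p halts in s' after t steps. *)
Inductive exec : program -> state w -> nat -> state w -> Prop :=
| exec_basic i s : exec (Basic i) s 1 (step i s)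
| exec_seq p q s t s' t' s'' :
    exec p s t s' -> exec q s' t' s'' -> exec (Seq p q) s (t + t') s''
| exec_if_true r p q s t s' :
    reg s r != 0 :> nat -> exec p s t s' -> exec (If r p q) s t.+1 s'
| exec_if_false r p q s t s' :
    reg s r = 0 :> nat -> exec q s t s' -> exec (If r p q) s t.+1 s'
| exec_while_true r p s t s' t' s'' :
    reg s r != 0 :> nat -> exec p s t s' -> exec (While r p) s' t' s'' ->
    exec (While r p) s (t + t').+1 s''
| exec_while_false r p s :
    reg s r = 0 :> nat -> exec (While r p) s 1 s.

(* Register 0 holds the query, register 1 the word size and register 2 the
   last position n - 1 of the array (n itself may be 2 ^ w). *)
Definition initial (x : word w) : state w :=
  State [eta fun _ => to_word w 0 with
           0 |-> x, 1 |-> to_word w w, 2 |-> to_word w #|S|.-1]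
        (fun _ => to_word w 0).

Definition computes (p : program) (x : word w) (t : nat) (y : word w) : Prop :=
  exists2 s, exec p (initial x) t s & reg s 0 = y.

End Execution.

(** * Probability and logarithms *)

Local Open Scope ring_scope.

(* For h uniformly distributed, E h holds with probability at least q. *)
Definition with_probability (R : realType) (w : nat) (q : R)
    (E : hash_family w -> Prop) : Prop :=
  exists2 G : {set hash_family w},
    q <= #|G|%:R / #|{: hash_family w}|%:R & forall h, h \in G -> E h.

Definition lg (R : realType) (z : R) : R := if z < 2 then 1 else ln z / ln 2.

(* Main.v *)
Require Import Defs.
From HB Require Import structures.
From mathcomp Require Import all_boot all_order all_algebra.
From mathcomp Require Import reals exp.
From mathcomp Require Import zify ring.

(* No hashing randomness is used: for every S there is a good index.
   Let n = |S|, let nu be about log n, and call a prefix of length l heavy if at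
   least nu l (l + 1) elements of S start with it.  There are at most n / nu heavy
   prefixes in all, so a perfect dictionary that maps each one to the range of its
   elements in the array, with fields of O(log n) bits, takes O(n) bits.  The seeds
   of the dictionary stay that short because a first multiplicative hash function
   maps the prefixes injectively to 2 nu + 1 bits.

   A query maintains a range [a, b] of array positions containing the rank of x.  If
   the elements with the prefix of length l of x are not all on one side of x,
   then D(x, S) < 2 ^ (w - l), so l is bounded by about k = w - log D(x, S);
   otherwise the comparison of x with the two ends of the range gives the rank.
   A table indexed by the first nu / 2 bits of x provides the initial range.
   Then the longest heavy prefix of x with elements on both sides is found in
   O(log k) steps by squaring the length until this fails, followed by a binary
   search.  As the next longer prefix is not heavy, the rank is within k ^ O(1) of
   one end of the range, and galloping from both ends finishes in O(log k)
   steps. *)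

Set Implicit Arguments.
Unset Strict Implicit.
Unset Printing Implicit Defensive.

Import Order.TTheory GRing.Theory Num.Theory.

(** * A structured language over the word RAM *)

(** The space bound has to hold even if [n] is far smaller than [w]; then one word of parameters may
    already be too much, and no field can afford to store a prefix. Three devices deal with this.
    The dictionary stores no keys: a slot holds a length and a range, and a hit is confirmed by
    comparing the query with the element of [S] at the start of that range. Prefixes longer than [n]
    are never probed, so that the first multiplier has at most [n + 1] bits; at length [n] the rank
    itself is small enough for galloping. Finally, the index has two formats. If everything fits
    into one word, the header fields are [n + 1] bits wide, a width that the program can compute
    from register 2; otherwise [w] is O(n) and nine full words are affordable. The index is empty if
    [log n] is below a fixed constant. *)

Inductive expr :=
| EV (v : nat)
| EC (k : nat)
| EB (o : binop) (e1 e2 : expr)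
| EI (e : expr)
| ES (e : expr).

(* Registers below [nvars] are program variables, the others hold the
   intermediate values of expressions. *)
Definition nvars := 50.

Fixpoint comp (d : nat) (e : expr) : program :=
  match e with
  | EV v => Basic (Op d Or v v)
  | EC k => Basic (Const d k)
  | EB o e1 e2 => Seq (comp d e1) (Seq (comp d.+1 e2) (Basic (Op d o d d.+1)))
  | EI e => Seq (comp d e) (Basic (ReadIndex d d))
  | ES e => Seq (comp d e) (Basic (ReadS d d))
  end.

Fixpoint cost (e : expr) : nat :=
  match e with
  | EV _ | EC _ => 1
  | EB _ e1 e2 => cost e1 + (cost e2 + 1)
  | EI e | ES e => cost e + 1
  end.

Fixpoint vok (e : expr) : bool :=
  match e with
  | EV v => v < nvars
  | EC _ => true
  | EB _ e1 e2 => vok e1 && vok e2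
  | EI e | ES e => vok e
  end.

Definition asg (v : nat) (e : expr) : program :=
  Seq (comp nvars e) (Basic (Op v Or nvars nvars)).
Definition cif (e : expr) (p q : program) : program :=
  Seq (comp nvars e) (If nvars p q).
Definition cwhile (e : expr) (p : program) : program :=
  Seq (comp nvars e) (While nvars (Seq p (comp nvars e))).

Definition env := nat -> nat.
Definition upd (r : env) (v k : nat) : env :=
  fun i => if Nat.eqb i v then k else r i.

Definition binop_nat (w : nat) (o : binop) (a b : nat) : nat :=
  match o with
  | Add => a + b
  | Defs.Sub => a + (2 ^ w - b)
  | Mul => a * b
  | And => Nat.land a b
  | Or  => Nat.lor a b
  | Xor => Nat.lxor a b
  | Shl => a * 2 ^ b
  | Shr => a %/ 2 ^ b
  | Ltn => nat_of_bool (a < b)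
  | Eqn => nat_of_bool (a == b)
  end.

Section Language.
Variables (w : nat) (S : {set word w}) (h : hash_family w) (B : seq bool).

Definition array : seq nat := map val (sorted_array S).
Definition read_index (a : nat) : nat :=
  \sum_(j < w) nth false B (a * w + j) * 2 ^ j.

Fixpoint evn (e : expr) (r : env) : nat :=
  match e with
  | EV v => r v
  | EC k => k %% 2 ^ w
  | EB o e1 e2 => binop_nat w o (evn e1 r) (evn e2 r) %% 2 ^ w
  | EI e => read_index (evn e r) %% 2 ^ w
  | ES e => nth 0 array (evn e r)
  end.

Definition agree (s : state w) (r : env) : Prop :=
  forall v, v < nvars -> reg s v = r v :> nat.

(** [d] is the bottom of a stack of scratch registers: the last clause protects the program
    variables, and also the left operand while the right one is evaluated. *)
Lemma exec_comp (e : expr) d s r : vok e -> nvars <= d -> agree s r ->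
  exists s', [/\ exec S h B (comp d e) s (cost e) s',
    reg s' d = evn e r :> nat & forall v, v < d -> reg s' v = reg s v].
Proof.
elim: e d s r => [v|k|o e1 IH1 e2 IH2|e IH|e IH] d s r /=.
- move=> vv dd sr; eexists; split; first by constructor.
    rewrite /= eqxx /= /eval_binop.
    have lorr (a : nat) : Nat.lor a a = a by exact: PeanoNat.Nat.lor_diag.
    by rewrite lorr /= modn_small ?sr // -sr.
  by move=> u ud /=; rewrite ltn_eqF.
- move=> _ dd sr; eexists; split; first by constructor.
    by rewrite /= eqxx.
  by move=> u ud /=; rewrite ltn_eqF.
- move=> /andP[v1 v2] dd sr.
  have [s1 [x1 r1 f1]] := IH1 d s r v1 dd sr.
  have sr1 : agree s1 r.
    by move=> v vv; rewrite f1 ?sr //; apply: leq_trans dd.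
  have [s2 [x2 r2 f2]] := IH2 d.+1 s1 r v2 (leqW dd) sr1.
  eexists; split.
  + apply: exec_seq x1 _; apply: exec_seq x2 _; constructor.
  + rewrite /= eqxx /= /eval_binop /= f2 // r1 r2.
    by case: (o) => //; rewrite -r1 -r2.
  + by move=> v vd /=; rewrite ltn_eqF // f2 ?f1 // ltnW.
- move=> ve dd sr.
  have [s1 [x1 r1 f1]] := IH d s r ve dd sr.
  eexists; split.
  + apply: exec_seq x1 _; constructor.
  + by rewrite /= eqxx /= /index_word /read_index r1.
  + by move=> v vd /=; rewrite ltn_eqF // f1.
- move=> ve dd sr.
  have [s1 [x1 r1 f1]] := IH d s r ve dd sr.
  eexists; split.
  + apply: exec_seq x1 _; constructor.
  + rewrite /= eqxx /= r1 /array.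
    have [lt|ge] := ltnP (evn e r) (size (sorted_array S)).
      by rewrite (nth_map (to_word w 0)).
    rewrite !nth_default ?size_map //=.
    by rewrite mod0n.
  + by move=> v vd /=; rewrite ltn_eqF // f1.
Qed.

Lemma exec_comp_nvars e s r : vok e -> agree s r ->
  exists s', [/\ exec S h B (comp nvars e) s (cost e) s',
    reg s' nvars = evn e r :> nat & agree s' r].
Proof.
move=> ve sr; have [s' [x1 r1 f1]] := exec_comp ve (leqnn _) sr.
by exists s'; split=> // v vv; rewrite f1 // sr.
Qed.

Definition ht (p : program) (r : env) (T : nat) (Q : env -> Prop) : Prop :=
  forall s, agree s r -> exists t s' r',
    [/\ exec S h B p s t s', t <= T, agree s' r' & Q r'].

Lemma ht_le p r T T' (Q : env -> Prop) : T <= T' -> ht p r T Q -> ht p r T' Q.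
Proof.
move=> TT H s /H[t [s' [r' [e le a q]]]].
by exists t, s', r'; split=> //; apply: leq_trans TT.
Qed.

Lemma ht_post p r T (Q Q' : env -> Prop) :
  ht p r T Q -> (forall r', Q r' -> Q' r') -> ht p r T Q'.
Proof.
by move=> H QQ s /H[t [s' [r' [e le a q]]]]; exists t, s', r'; split=> //; apply: QQ.
Qed.

Lemma ht_asg v e r T (Q : env -> Prop) : vok e -> v < nvars ->
  cost e + 1 <= T -> Q (upd r v (evn e r)) -> ht (asg v e) r T Q.
Proof.
move=> ve vv le q s /(exec_comp_nvars ve)[s1 [x1 r1 a1]].
exists (cost e + 1); eexists; exists (upd r v (evn e r)); split=> //.
  by apply: exec_seq x1 _; constructor.
move=> u uv; rewrite /upd /=.
have -> : Nat.eqb u v = (u == v).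
  by apply/idP/eqP => /PeanoNat.Nat.eqb_eq.
case: eqP => [_|_]; last exact: a1.
rewrite /eval_binop /= r1.
have lorr (a : nat) : Nat.lor a a = a by exact: PeanoNat.Nat.lor_diag.
by rewrite lorr modn_small // -r1.
Qed.

Lemma ht_seq p q r T1 T2 T (Q : env -> Prop) : T1 + T2 <= T ->
  ht p r T1 (fun r1 => ht q r1 T2 Q) -> ht (Seq p q) r T Q.
Proof.
move=> le hp s /hp[t [s' [r' [x1 le1 a1 hq]]]].
have [t2 [s2 [r2 [x2 le2 a2 q2]]]] := hq s' a1.
exists (t + t2), s2, r2; split=> //; first exact: exec_seq x1 x2.
by apply: leq_trans le; apply: leq_add.
Qed.

Lemma ht_if e p q r T T' (Q : env -> Prop) : vok e -> cost e + 1 + T <= T' ->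
  (evn e r != 0 -> ht p r T Q) -> (evn e r = 0 -> ht q r T Q) ->
  ht (cif e p q) r T' Q.
Proof.
move=> ve le hp hq s /(exec_comp_nvars ve)[s1 [x1 r1 a1]].
have [e0|e0] := eqVneq (evn e r) 0.
  have [t2 [s2 [r2 [x2 le2 a2 q2]]]] := hq e0 s1 a1.
  exists (cost e + t2.+1), s2, r2; split=> //.
    by apply: exec_seq x1 _; apply: exec_if_false; rewrite // r1.
  by apply: leq_trans le; rewrite -addnA leq_add2l add1n ltnS.
have [t2 [s2 [r2 [x2 le2 a2 q2]]]] := hp e0 s1 a1.
exists (cost e + t2.+1), s2, r2; split=> //.
  by apply: exec_seq x1 _; apply: exec_if_true; rewrite // r1.
by apply: leq_trans le; rewrite -addnA leq_add2l add1n ltnS.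
Qed.

(** The index [k] of the invariant is a variant: it drops in every round, so there are at most [k]
    rounds and [k + 1] tests. *)
Lemma ht_while e p (I : nat -> env -> Prop) Tb (Q : env -> Prop) : vok e ->
  (forall k r, I k r -> evn e r = 0 -> Q r) ->
  (forall k r, I k r -> evn e r != 0 ->
     ht p r Tb (fun r' => exists2 k', k' < k & I k' r')) ->
  forall k r T, I k r -> k.+1 * (Tb + cost e + 1) <= T ->
  ht (cwhile e p) r T Q.
Proof.
move=> ve I0 IS k; elim/ltn_ind: k => k IH r T Ik le s sr.
have [s1 [x1 r1 a1]] := exec_comp_nvars ve sr.
have [e0|e0] := eqVneq (evn e r) 0.
  exists (cost e + 1), s1, r; split=> //; last exact: I0 Ik e0.
    by apply: exec_seq x1 _; apply: exec_while_false; rewrite r1.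
  by apply: leq_trans le; rewrite mulSn; set X := k * _; lia.
have [t2 [s2 [r2 [x2 le2 a2 [k' k'k Ik']]]]] := IS _ _ Ik e0 s1 a1.
have [t3 [s3 [r3 [x3 le3 a3 q3]]]] :=
  IH k' k'k r2 (k'.+1 * (Tb + cost e + 1)) Ik' (leqnn _) s2 a2.
(* The run given by induction begins with an evaluation of [e]; it is cut off and attached to the
   round just executed, because the loop body ends with that evaluation. *)
inversion x3; subst.
exists (cost e + (t2 + t + t').+1), s3, r3; split=> //.
  apply: exec_seq x1 _; apply: exec_while_true; rewrite ?r1 //; last by eauto.
  by apply: exec_seq x2 _; eauto.
apply: leq_trans le.
have : k'.+1 * (Tb + cost e + 1) + (Tb + cost e + 1) <= k.+1 * (Tb + cost e + 1).
  by rewrite addnC -mulSn leq_mul2r ltnS k'k orbT.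
lia.
Qed.

End Language.

(** * Ranks in the sorted array *)

Definition rank_in (s : seq nat) (y : nat) : nat := count (fun z => z < y) s.

Lemma nth_lt_rank s y i : sorted leq s -> i < size s ->
  (nth 0 s i < y) = (i < rank_in s y).
Proof.
elim: s i => [|a s IH] i //= ss; rewrite /rank_in /= -/(rank_in s y).
have as_ : all (leq a) s by apply: order_path_min ss; apply: leq_trans.
have [ay|ya] := ltnP a y.
  by case: i => [|i] lt; [rewrite ay|rewrite /= IH // (path_sorted ss)].
have -> : rank_in s y = 0.
  apply/eqP; rewrite -leqn0 leqNgt -has_count; apply/hasPn => z zs /=.
  by rewrite -leqNgt (leq_trans ya) // (allP as_).
case: i => [|i] /= lt; apply/negbTE; rewrite -leqNgt //.
by rewrite (leq_trans ya) // (allP as_) // mem_nth.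
Qed.

Lemma rank_le s y z : y <= z -> rank_in s y <= rank_in s z.
Proof. by move=> yz; apply: sub_count => a /= ay; apply: leq_trans yz. Qed.

Lemma rank_size s y : rank_in s y <= size s.
Proof. exact: count_size. Qed.

Lemma rank_window s y d : uniq s -> rank_in s (y + d) <= rank_in s y + d.
Proof.
move=> us; rewrite /rank_in.
have -> : count (fun z => z < y + d) s =
  count (fun z => z < y) s + count (fun z => y <= z < y + d) s.
  rewrite -[RHS](count_predUI) [X in _ = _ + X](_ : _ = 0) ?addn0.
    by apply: eq_count => z /=; lia.
  by apply/eqP; rewrite -leqn0 leqNgt -has_count; apply/hasPn => z _ /=; lia.
rewrite leq_add2l -size_filter -[leqRHS](size_iota y d).
apply: uniq_leq_size; first exact: filter_uniq.
by move=> z; rewrite mem_filter mem_iota => /andP[].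
Qed.

Section Array.
Variables (w : nat) (S : {set word w}).

Lemma array_perm : perm_eq (array S) (map val (enum S)).
Proof. by rewrite /array /sorted_array perm_map // perm_sort. Qed.

Lemma size_array : size (array S) = #|S|.
Proof. by rewrite (perm_size array_perm) size_map cardE. Qed.

Lemma card_le_words : #|S| <= 2 ^ w.
Proof. by apply: leq_trans (max_card _) _; rewrite card_ord. Qed.

Lemma uniq_array : uniq (array S).
Proof.
by rewrite (perm_uniq array_perm) map_inj_uniq ?enum_uniq //; apply: val_inj.
Qed.

Lemma sorted_array_leq : sorted leq (array S).
Proof.
rewrite /array /sorted_array sorted_map.
by apply: sort_sorted => a b; apply: leq_total.
Qed.

Lemma mem_array (y : word w) : (val y \in array S) = (y \in S).
Proof.
rewrite (perm_mem array_perm) mem_map ?mem_enum //; exact: val_inj.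
Qed.

Lemma array_lt i : nth 0 (array S) i < 2 ^ w.
Proof.
have [lt|ge] := ltnP i (size (array S)); last by rewrite nth_default ?expn_gt0.
by have /mapP[y _ ->] := mem_nth 0 lt; apply: ltn_ord.
Qed.

Local Notation n := #|S|.
Local Notation A := (nth 0 (array S)).
Local Notation rk := (rank_in (array S)).

Lemma array_lt_rank y i : i < n -> (A i < y) = (i < rk y).
Proof. by move=> lt; rewrite nth_lt_rank ?size_array // sorted_array_leq. Qed.

Lemma array_ltE i j : i < n -> j < n -> (A i < A j) = (i < j).
Proof.
move=> iN jn.
have lt : {in [pred i | i < n] &, {homo A : i j / i < j}}.
  rewrite -size_array; apply: sorted_ltn_nth; first exact: ltn_trans.
  by rewrite ltn_sorted_uniq_leq uniq_array sorted_array_leq.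
have [ij|ji|->] := ltngtP i j; last by rewrite ltnn.
  by rewrite lt.
by rewrite ltnNge ltnW // lt.
Qed.

Lemma array_leE i j : i < n -> j < n -> (A i <= A j) = (i <= j).
Proof. by move=> iN jn; rewrite leqNgt array_ltE // -leqNgt. Qed.

Lemma array_mem i : i < n -> exists2 y, y \in S & A i = val y.
Proof.
rewrite -size_array => lt.
have /mapP[y yS ->] := mem_nth 0 lt; exists y => //.
by rewrite -mem_array map_f.
Qed.

Lemma mem_array_nth y : y \in S -> exists2 i, i < n & A i = val y.
Proof.
rewrite -mem_array => yS; exists (index (val y) (array S)).
  by rewrite -size_array index_mem.
by rewrite nth_index.
Qed.

Lemma xminusP (x : word w) :
  match xminus S x with
  | Some y => [/\ y \in S, y < x & A (rk x).-1 = val y /\ 0 < rk x]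
  | None => rk x = 0
  end.
Proof.
have last_lt : 0 < rk x -> (rk x).-1 < n.
  by move=> rk0; rewrite prednK // -size_array rank_size.
rewrite /xminus; case: pickP => [y /and3P[yS yx /forallP ymax]|no].
  have [i iN Ai] := mem_array_nth yS.
  have irk : i < rk x by rewrite -array_lt_rank // Ai.
  have rk0 : 0 < rk x by apply: leq_ltn_trans irk.
  have [z zS Az] := array_mem (last_lt rk0).
  have zx : z < x by rewrite -[nat_of_ord z]Az array_lt_rank ?last_lt // prednK.
  have := ymax z; rewrite zS zx /= => zy.
  split=> //; split=> //; apply/eqP; rewrite eqn_leq Az [_ <= _]zy /=.
  by rewrite -Ai -[\val z]Az array_leE ?last_lt //; lia.
apply/eqP; rewrite -leqn0 leqNgt; apply/negP => rk0.
have [z zS Az] := array_mem (last_lt rk0).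
have zx : z < x by rewrite -[nat_of_ord z]Az array_lt_rank ?last_lt // prednK.
have := no z; rewrite zS zx /=.
move/negbT/forallPn => [u]; rewrite !negb_imply -ltnNge => /and3P[uS ux zu].
have [i iN Ai] := mem_array_nth uS.
have : A i < x by rewrite Ai.
have : A (rk x).-1 < A i by rewrite Az Ai.
by rewrite array_ltE ?last_lt // array_lt_rank //; lia.
Qed.

(** The position of x^- is the rank minus 1, and subtracting 1 modulo [2 ^ w] turns rank 0 into the
    all-ones word that stands for -1. The program therefore needs no case distinction at the end. *)
Lemma predecessor_answerE (x : word w) :
  predecessor_answer S x = (rk x + (2 ^ w - 1)) %% 2 ^ w :> nat.
Proof.
rewrite /predecessor_answer; have := xminusP x.
case: (xminus S x) => [y [yS yx [Ay rk0]]|rk0] /=.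
  have -> : rk x + (2 ^ w - 1) = (rk x).-1 + 2 ^ w.
    by have := expn_gt0 2 w; lia.
  rewrite modnDr; congr (_ %% _).
  rewrite -(index_map val_inj) -/(array S) /= -[X in index X _]Ay index_uniq //.
    by rewrite size_array prednK // -size_array rank_size.
  exact: uniq_array.
by rewrite rk0 add0n subn1.
Qed.

Lemma xplusP (x : word w) i : i < n -> x <= A i ->
  exists2 z, xplus S x = Some z & x <= z <= A i.
Proof.
move=> iN xAi; rewrite /xplus; case: pickP => [z /and3P[zS xz /forallP zmin]|no].
  exists z => //; rewrite xz /=.
  have [u uS Au] := array_mem iN.
  by have := zmin u; rewrite uS -Au xAi.
have rkn : rk x < n.
  by apply: (leq_ltn_trans _ iN); rewrite leqNgt -array_lt_rank // -leqNgt.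
have [z zS Az] := array_mem rkn.
have xz : x <= z by rewrite -[nat_of_ord z]Az leqNgt array_lt_rank // ltnn.
have := no z; rewrite zS xz /= => /negbT/forallPn[u].
rewrite !negb_imply -ltnNge => /and3P[uS xu uz].
have [j jn Aj] := mem_array_nth uS.
have : A j < A (rk x) by rewrite Aj Az.
have : ~~ (A j < x) by rewrite Aj -leqNgt.
by rewrite array_ltE // array_lt_rank //; lia.
Qed.

(** Both neighbours of [x] lie between [A i] and [A j]; positivity comes from x^- being strictly
    smaller than [x]. *)
Lemma distance_bound (x : word w) i j lo hi : i < n -> j < n ->
  A i < x <= A j -> lo <= A i -> A j < hi -> 0 < distance S x < hi - lo.
Proof.
move=> iN jn /andP[Ax xA] loi jhi; rewrite /distance.
have [z -> /andP[xz zA]] := xplusP jn xA.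
have := xminusP x; case: (xminus S x) => [y [yS yx [Ay rk0]]|rk0]; last first.
  by move: Ax; rewrite array_lt_rank // rk0.
have Aiy : A i <= y.
  rewrite leqNgt -[nat_of_ord y]Ay.
  have irk : i < rk x by rewrite -array_lt_rank.
  have rkn : (rk x).-1 < n by rewrite prednK // -size_array rank_size.
  by rewrite array_ltE //; lia.
rewrite gtn_max leq_max; apply/andP; split; lia.
Qed.

End Array.

(** * Multiplicative hashing *)

(** Multiply-shift hashing: the top [r] of the low [u] bits of the product. Over the odd multipliers
    it is universal up to a factor 2. *)
Definition mhash (u r a k : nat) : nat := (a * k %% 2 ^ u) %/ 2 ^ (u - r).

Lemma mhash_lt u r a k : r <= u -> mhash u r a k < 2 ^ r.
Proof.
move=> ru; rewrite /mhash ltn_divLR ?expn_gt0 // -expnD subnKC //.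
by rewrite ltn_pmod ?expn_gt0.
Qed.

Lemma mhash1 u k : k < 2 ^ u -> mhash u u 1 k = k.
Proof. by move=> ku; rewrite /mhash mul1n subnn divn1 modn_small. Qed.

Lemma pow2_odd_part d : 0 < d -> exists s o, d = 2 ^ s * o /\ odd o.
Proof.
move=> d0; have [o co ->] := pfactor_coprime (isT : prime 2) d0.
exists (logn 2 d), o; split; first by rewrite mulnC.
by rewrite coprime2n in co.
Qed.

(** Two residues with the same top [r] bits lie in one block of length [2 ^ (u - r)], so their
    difference is close to 0 modulo [2 ^ u]. *)
Lemma mhash_collision u r a x d : r <= u ->
  mhash u r a x = mhash u r a (x + d) ->
  let z := a * d %% 2 ^ u in z < 2 ^ (u - r) \/ 2 ^ u < z + 2 ^ (u - r).
Proof.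
move=> ru; rewrite /mhash mulnDr; set P := 2 ^ u; set W := 2 ^ (u - r).
have P0 : 0 < P by rewrite expn_gt0.
have W0 : 0 < W by rewrite expn_gt0.
rewrite -modnDm; set X := a * x %% P; set z := a * d %% P => e /=.
have XP : X < P by apply: ltn_pmod.
have zP : z < P by apply: ltn_pmod.
have eX := divn_eq X W; have eY := divn_eq ((X + z) %% P) W.
have lX := ltn_pmod X W0; have lY := ltn_pmod ((X + z) %% P) W0.
have [lt|ge] := ltnP (X + z) P.
  left; rewrite (modn_small lt) in eY lY e; rewrite -e in eY; lia.
right; have eM : (X + z) %% P = X + z - P.
  by rewrite -{1}(subnK ge) modnDr modn_small; lia.
rewrite eM in eY lY e; rewrite -e in eY; lia.
Qed.

Lemma odd_mul_inj u o a b : odd o -> a < 2 ^ u -> b < 2 ^ u ->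
  a * o = b * o %[mod 2 ^ u] -> a = b.
Proof.
move=> oo; wlog le : a b / b <= a => [hw|] au bu e.
  have [ba|/ltnW ab] := leqP b a; first exact: hw.
  by apply/esym/hw.
have := eqn_mod_dvd (2 ^ u) (leq_mul le (leqnn o)).
rewrite e eqxx -mulnBl => /esym; rewrite Gauss_dvdl; last first.
  by rewrite coprimeXl // coprime2n.
move=> dv; have [ab|ba] := posnP (a - b); first lia.
have := dvdn_leq ba dv; lia.
Qed.

(** Write [y - x] as [2 ^ s * o] with [o] odd. A collision forces [a * o] modulo [c = 2 ^ (u - s)]
    to be close to 0, and multiplication by [o] is injective on multipliers, so it suffices to count
    residues. Among the [2 ^ (u - 1)] odd multipliers this is a collision probability of at most
    [2 / 2 ^ r]. *)
Lemma mhash_collision_count u r x y : x < y < 2 ^ u -> r <= u ->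
  #|[pred a : 'I_(2 ^ u) | odd a & mhash u r a x == mhash u r a y]|
    <= 2 ^ (u - r).
Proof.
move=> /andP[xy yu] ru.
have [|s [o [de oo]]] := @pow2_odd_part (y - x); first by rewrite subn_gt0.
have o0 : 0 < o by case: (o) oo.
have su : s < u.
  rewrite -(ltn_exp2l _ _ (isT : 1 < 2)); apply: leq_ltn_trans (leq_pmulr _ o0) _.
  by rewrite -de; lia.
set P := 2 ^ u; set c := 2 ^ (u - s).
have Pc : P = 2 ^ s * c by rewrite -expnD subnKC // ltnW.
have c0 : 0 < c by rewrite expn_gt0.
have s0 : 0 < 2 ^ s by rewrite expn_gt0.
have evc : odd c = false by rewrite oddX subn_eq0 leqNgt su.
pose v (a : nat) := a * o %% c.
have vodd (a : nat) : odd a -> odd (v a).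
  move=> oa; have : odd (a * o) by rewrite oddM oa.
  by rewrite {1}(divn_eq (a * o) c) oddD oddM evc andbF.
have vlt (a : nat) : v a < c by apply: ltn_pmod.
have close (a : nat) : mhash u r a x == mhash u r a y ->
    2 ^ s * v a < 2 ^ (u - r) \/ 2 ^ s * c < 2 ^ s * v a + 2 ^ (u - r).
  rewrite -(subnKC (ltnW xy)) => /eqP /(mhash_collision ru).
  by rewrite de mulnCA -/P Pc -muln_modr.
(* If [u - r <= s], nonzero multiples of [2 ^ s] modulo [2 ^ u] are too far from 0 for any
   collision. *)
have [rs|sr] := leqP (u - r) s.
  rewrite (_ : #|_| = 0) //; apply: eq_card0 => a; rewrite !inE.
  apply/negP => /andP[oa /close].
  have lew : 2 ^ (u - r) <= 2 ^ s by rewrite leq_exp2l.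
  have := vlt a; have := odd_gt0 (vodd a oa).
  move: lew s0; move: (2 ^ s) (2 ^ (u - r)) (v a) => p W t lew p0 t0 tc.
  have : p * t.+1 <= p * c by rewrite leq_mul2l tc orbT.
  have : p * 1 <= p * t by rewrite leq_mul2l t0 orbT.
  by rewrite muln1 mulnS => ? ? []; lia.
set m := 2 ^ (u - r - s).
have We : 2 ^ (u - r) = 2 ^ s * m by rewrite -expnD; congr (2 ^ _); lia.
have {}close (a : nat) : mhash u r a x == mhash u r a y -> v a < m \/ c < v a + m.
  by move=> /close; rewrite We -mulnDr !ltn_pmul2l.
have mc : m <= c by rewrite leq_exp2l //; lia.
have evm : odd m = false by rewrite oddX subn_eq0 leqNgt sr.
pose t (a : nat) := a * o %% P.
(* Both ends of the range of residues are folded into one block of [m] values without loss: near 0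
   the odd [v a] is kept, near [c] it becomes the even [c - v a - 1]. *)
pose code (a : nat) := t a %/ c * m + (if v a < m then v a else c - v a - 1).
have cP : c %| P by rewrite Pc dvdn_mull.
have tv (a : nat) : t a %% c = v a by rewrite /t /v modn_dvdm.
have vm (a : nat) : mhash u r a x == mhash u r a y ->
    (if v a < m then v a else c - v a - 1) < m.
  move=> /close; move: (v a) (vlt a) => b bc [bm|cb]; first by rewrite bm.
  case: ifP => // _; rewrite -subnDA addn1 ltn_subLR; last exact: bc.
  by rewrite addSn; apply: leqW; apply: cb.
have code_lt (a : nat) : mhash u r a x == mhash u r a y -> code a < 2 ^ (u - r).
  move=> /vm lt; rewrite We /code.
  have : t a %/ c < 2 ^ s by rewrite ltn_divLR // -Pc ltn_pmod ?expn_gt0.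
  rewrite -(leq_pmul2r (_ : 0 < m)) ?expn_gt0 //; move: lt.
  by move: (if _ then _ else _) => z; rewrite mulSn; lia.
suff inj : {in [pred a : 'I_(2 ^ u) | odd a & mhash u r a x == mhash u r a y] &,
    injective (fun a : 'I_(2 ^ u) => to_word (u - r) (code a))}.
  by rewrite -(card_in_imset inj) (leq_trans (max_card _)) // card_ord.
move=> a b; rewrite !inE => /andP[oa ha] /andP[ob hb] /(congr1 val) /=.
rewrite !modn_small ?code_lt // /code => e.
have m0 : 0 < m by rewrite expn_gt0.
have eq1 : t a %/ c = t b %/ c.
  have := congr1 (fun k => k %/ m) e.
  by rewrite !divnMDl // !(divn_small (vm _ _)) // !addn0.
have eq2 : v a = v b.
  move: e; rewrite eq1 => /addnI.
  have ova := vodd a oa; have ovb := vodd b ob.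
  have mixed p q : q < c -> odd p -> odd q -> p <> c - q - 1.
    move=> qc op oq pe; have : odd (p + q).+1 = odd c by congr odd; lia.
    by rewrite /= oddD op oq evc.
  have := vlt a; have := vlt b => lb la.
  case: ifP => _; case: ifP => _ // e.
  - by case: (mixed _ _ lb ova ovb).
  - by case: (mixed _ _ la ovb ova).
  - by move: e la lb; clear; move: (v a) (v b) => p q; lia.
apply: val_inj; apply: (odd_mul_inj oo (ltn_ord a) (ltn_ord b)).
by rewrite -/P -/(t a) -/(t b) (divn_eq (t a) c) (divn_eq (t b) c) eq1 !tv eq2.
Qed.

Definition collisions (f : nat -> nat) (K : seq nat) : nat :=
  \sum_(x <- K) \sum_(y <- K) ((x != y) && (f x == f y)).

Lemma count_odd m : \sum_(a < 2 * m | odd a) 1 = m.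
Proof.
rewrite -(big_mkord (fun a => odd a) (fun _ => 1)).
elim: m => [|m IH]; first by rewrite muln0 big_geq.
rewrite mulnS add2n big_mkcond big_nat_recr // big_nat_recr //=.
by rewrite -big_mkcond IH /= oddM /= addn0 addn1.
Qed.

(* An odd multiplier that does at least as well as the average over the
   [2 ^ (u - 1)] odd multipliers. *)
Lemma exists_mhash u r (K : seq nat) : 0 < u -> r <= u ->
  (forall k, k \in K -> k < 2 ^ u) ->
  exists2 a, a < 2 ^ u & collisions (mhash u r a) K * 2 ^ r <= 2 * size K ^ 2.
Proof.
move=> u0 ru Ku.
have [/existsP[a /andP[_ h]]|/existsPn no] := boolP [exists a : 'I_(2 ^ u),
    odd a && (collisions (mhash u r a) K * 2 ^ r <= 2 * size K ^ 2)].
  by exists a.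
have u2 : 2 ^ u = 2 * 2 ^ u.-1 by rewrite -expnS prednK.
have lb : \sum_(a < 2 ^ u | odd a) (2 * size K ^ 2).+1 <=
    \sum_(a < 2 ^ u | odd a) collisions (mhash u r a) K * 2 ^ r.
  apply: leq_sum => a oa; have := no a; rewrite oa /=; lia.
have ub : \sum_(a < 2 ^ u | odd a) collisions (mhash u r a) K
    <= size K ^ 2 * 2 ^ (u - r).
  rewrite /collisions exchange_big /=.
  have -> : size K ^ 2 * 2 ^ (u - r) =
      \sum_(x <- K) \sum_(y <- K) 2 ^ (u - r).
    by rewrite !big_const_seq !count_predT !iter_addn_0; nia.
  rewrite !big_seq; apply: leq_sum => x /Ku xu; rewrite exchange_big /=.
  rewrite !big_seq; apply: leq_sum => y /Ku yu.
  have [->|xy] := eqVneq x y.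
    by rewrite big1.
  apply: leq_trans (_ : #|[pred a : 'I_(2 ^ u) |
      odd a & mhash u r a x == mhash u r a y]| <= _).
    rewrite -sum1_card big_mkcondr /=; apply: leq_sum => a _.
    by case: eqP.
  have [lt|lt|/eqP] := ltngtP x y; last by rewrite (negbTE xy).
    by apply: mhash_collision_count; rewrite ?lt.
  rewrite (eq_card (B := [pred a : 'I_(2 ^ u) |
      odd a & mhash u r a y == mhash u r a x])).
    by apply: mhash_collision_count; rewrite ?lt.
  by move=> a; rewrite !inE [X in _ && X]eq_sym.
rewrite -big_distrl /= in lb; suff : false by [].
rewrite -(ltnn (\sum_(a < 2 ^ u | odd a) (2 * size K ^ 2).+1)).
apply: leq_ltn_trans lb _.
apply: leq_ltn_trans (leq_mul ub (leqnn _)) _.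
have -> : \sum_(a < 2 ^ u | odd a) (2 * size K ^ 2).+1 =
    (2 * size K ^ 2).+1 * 2 ^ u.-1.
  have := count_odd (2 ^ u.-1); rewrite -u2 => <-; rewrite big_distrr /=.
  by apply: eq_bigr => a _; rewrite muln1.
rewrite -mulnA -expnD subnK // u2 mulnA ltn_pmul2r ?expn_gt0 //.
by rewrite mulnC ltnS.
Qed.

(** * A two-level perfect dictionary *)

Lemma collisions0_inj f K : collisions f K = 0 -> {in K &, injective f}.
Proof.
move=> c0 x y xK yK fxy; apply/eqP/negPn/negP => xy; move: c0.
rewrite /collisions (big_rem x) //= (big_rem y) //= xy fxy eqxx /=; lia.
Qed.

Lemma uniq_map_inj (f : nat -> nat) K : uniq (map f K) -> {in K &, injective f}.
Proof.
elim: K => // k K IH /= /andP[fk uK] x y; rewrite !inE.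
case/predU1P => [->|xK] /predU1P[->|yK] // e.
- by rewrite e map_f in fk.
- by rewrite -e map_f in fk.
- exact: IH e.
Qed.

(** In the first case some multiplier has fewer than one collision, hence none. If [r = u], the
    multiplier 1 gives the identity; this alternative allows [r] to be capped by the width of the
    universe. *)
Lemma exists_injective_mhash u r (K : seq nat) : 0 < u -> r <= u ->
  uniq K -> (forall k, k \in K -> k < 2 ^ u) ->
  2 * size K ^ 2 < 2 ^ r \/ r = u ->
  exists2 a, a < 2 ^ u & uniq [seq mhash u r a k | k <- K].
Proof.
move=> u0 ru uK Ku [lt|->]; last first.
  exists 1; first by rewrite -[X in X < _](expn0 2) ltn_exp2l.
  rewrite map_inj_in_uniq // => x y /Ku xu /Ku yu.
  by rewrite !mhash1.
have [a au le] := exists_mhash u0 ru Ku.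
exists a => //; rewrite map_inj_in_uniq //; apply: collisions0_inj.
have := leq_ltn_trans le lt; case: (collisions _ _) => // m.
by rewrite mulSn ltnNge leq_addr.
Qed.

(** Both sides count the ordered pairs of keys in a common bucket; [size K] accounts for the
    diagonal. *)
Lemma sum_bucket_sq (f : nat -> nat) (K : seq nat) m : uniq K ->
  (forall k, k \in K -> f k < m) ->
  \sum_(g < m) (count (fun k => f k == g) K) ^ 2 = size K + collisions f K.
Proof.
move=> uK fm.
have -> : size K = \sum_(x <- K) \sum_(y <- K) (x == y).
  rewrite -sum1_size; apply: eq_big_seq => x xK.
  rewrite (bigD1_seq x) //= eqxx big1 // => y; rewrite eq_sym => /negbTE ->.
  by [].
rewrite /collisions -big_split /=.
have cE g : count (fun k => f k == g) K = \sum_(k <- K) (f k == g).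
  by rewrite -sum1_count big_mkcond; apply: eq_bigr => k _; case: eqP.
under eq_bigr => g _ do rewrite cE -mulnn big_distrl /=.
rewrite exchange_big /=; apply: eq_big_seq => x xK.
under eq_bigr => g _ do rewrite big_distrr /=.
rewrite exchange_big /= -big_split /=; apply: eq_big_seq => y yK.
rewrite (bigD1 (Ordinal (fm _ xK))) //= eqxx big1 => [|g gx].
  by rewrite addn0 mul1n eq_sym; have [->|_] := eqVneq x y; rewrite ?eqxx.
by have := gx; rewrite -val_eqE /= eq_sym => /negbTE ->.
Qed.

Lemma up_log_le b : 2 ^ up_log 2 (2 * b ^ 2).+1 <= 4 * b ^ 2 + (b == 0).
Proof.
case: b => [|b]; first by [].
have /andP[lt _] := @up_log_bounds 2 (2 * b.+1 ^ 2).+1 isT isT.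
rewrite addn0; move: (b.+1 ^ 2) (expn_gt0 b.+1 2) lt => q /= q0.
by case: (up_log _ _) => [|k] /= lt; rewrite ?expn0 ?expnS; lia.
Qed.

Lemma up_log_double N : 2 ^ up_log 2 N <= 2 * N + 1.
Proof.
have [|N1] := leqP N 1; first by case: N => [|[|]].
have /andP[lt _] := @up_log_bounds 2 N isT N1.
case: (up_log _ _) lt => [|k] /=; first lia.
by rewrite expnS; lia.
Qed.

Section Dictionary.
Variables (u r a0 a1 s : nat) (seed off rb : nat -> nat).

Definition dict_bucket (k : nat) : nat := mhash r s a1 (mhash u r a0 k).
Definition dict_slot (k : nat) : nat :=
  let g := dict_bucket k in
  off g + mhash r (rb g) (seed g) (mhash u r a0 k).
End Dictionary.

(** The scheme of Fredman, Komlos and Szemeredi, after an injective reduction to [r] bits. With at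
    least [N = size K] buckets there is a multiplier with at most [2 N] collisions, so the squares
    of the bucket sizes sum to at most [3 N]; a bucket of size [b > 0] is hashed injectively into at
    most [4 b ^ 2] slots. *)
Lemma exists_dictionary u r (K : seq nat) : 0 < u -> 0 < r <= u ->
  uniq K -> (forall k, k \in K -> k < 2 ^ u) ->
  2 * size K ^ 2 < 2 ^ r \/ r = u ->
  exists a0 a1 s seed off rb,
  [/\ [/\ a0 < 2 ^ u, a1 < 2 ^ r, s <= r & 2 ^ s <= 2 * size K + 1],
   forall g, g < 2 ^ s ->
    [/\ seed g < 2 ^ r, rb g <= r & off g + 2 ^ rb g <= 12 * size K + 1] &
   {in K &, injective (dict_slot u r a0 a1 s seed off rb)}].
Proof.
move=> u0 /andP[r0 ru] uK Ku hr.
have [a0 a0u] := exists_injective_mhash u0 ru uK Ku hr.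
set K1 := map _ _ => uK1.
have K1r k : k \in K1 -> k < 2 ^ r by case/mapP => k' _ ->; apply: mhash_lt.
have sK1 : size K1 = size K by rewrite size_map.
pose N := size K; pose s := up_log 2 N.
have sr : s <= r.
  apply: up_log_min => //; rewrite /N -sK1 -(size_iota 0 (2 ^ r)).
  by apply: uniq_leq_size => // k /K1r; rewrite mem_iota add0n.
have [a1 a1r le1] := exists_mhash r0 sr K1r.
have {}le1 : collisions (mhash r s a1) K1 <= 2 * N.
  have [N0|N0] := posnP N.
    have K10 : K1 = [::] by apply: size0nil; rewrite sK1.
    by rewrite K10 /collisions big_nil.
  rewrite -(leq_pmul2r N0) -mulnA mulnn.
  apply: leq_trans (_ : collisions (mhash r s a1) K1 * 2 ^ s <= _).
    by rewrite leq_mul2l up_logP ?orbT.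
  by rewrite sK1 in le1.
pose Kg g := [seq k <- K1 | mhash r s a1 k == g].
pose b g := size (Kg g).
pose rb g := minn r (up_log 2 (2 * b g ^ 2).+1).
pose P g a := uniq [seq mhash r (rb g) a k | k <- Kg g].
pose seed g := find (P g) (iota 0 (2 ^ r)).
pose off g := \sum_(g' < g) 4 * b g' ^ 2.
have rbr g : rb g <= r by apply: geq_minl.
have has_seed g : has (P g) (iota 0 (2 ^ r)).
  have Kgr k : k \in Kg g -> k < 2 ^ r by rewrite mem_filter => /andP[_ /K1r].
  have fits : 2 * size (Kg g) ^ 2 < 2 ^ rb g \/ rb g = r.
    rewrite /rb; case: (leqP r) => _; first by right.
    by left; rewrite -/(b g); apply: up_logP.
  have [a ar Pa] :=
    exists_injective_mhash r0 (rbr g) (filter_uniq _ uK1) Kgr fits.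
  by apply/hasP; exists a => //; rewrite mem_iota add0n.
have seed_lt g : seed g < 2 ^ r by have := has_seed g; rewrite has_find size_iota.
have seedP g : P g (seed g).
  by have := nth_find 0 (has_seed g); rewrite nth_iota // -[X in _ < X](size_iota 0) -has_find.
have sumb : \sum_(g < 2 ^ s) 4 * b g ^ 2 <= 12 * N.
  rewrite -big_distrr /= /b.
  under eq_bigr => g _ do rewrite size_filter.
  rewrite sum_bucket_sq // => [|k _]; last exact: mhash_lt.
  by rewrite sK1; move: le1; rewrite -/N; lia.
have off_mono g g' : g < g' -> off g + 4 * b g ^ 2 <= off g'.
  move=> lt; rewrite /off -[X in X + _](big_mkord xpredT (fun g => 4 * b g ^ 2)).
  rewrite -big_nat_recr //= -(big_mkord xpredT (fun g => 4 * b g ^ 2)).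
  by rewrite [X in _ <= X](big_cat_nat (n := g.+1)) //= leq_addr.
(* An empty bucket has one slot but is allotted none. The overlap is harmless, as no key falls into
   such a bucket, and it explains the [+ 1] in the bound on the slots. *)
have rb_size g : 2 ^ rb g <= 4 * b g ^ 2 + (b g == 0).
  by apply: leq_trans (up_log_le _); rewrite leq_exp2l // geq_minr.
exists a0, a1, s, seed, off, rb; split.
- by split=> //; apply: up_log_double.
- move=> g gs; split=> //.
  have := rb_size g; have := leq_trans (off_mono _ _ gs) sumb.
  by rewrite -/N; case: (b g == 0); lia.
- have mono x y : x \in K -> y \in K ->
      dict_bucket u r a0 a1 s x < dict_bucket u r a0 a1 s y ->
      dict_slot u r a0 a1 s seed off rb x < dict_slot u r a0 a1 s seed off rb y.
    move=> xK yK lt; rewrite /dict_slot /=.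
    apply: leq_trans (leq_addr _ _); apply: leq_trans (off_mono _ _ lt).
    rewrite ltn_add2l; apply: leq_trans (mhash_lt _ _ _) _ => //.
    set g := dict_bucket _ _ _ _ _ x.
    have := rb_size g; have : 0 < b g.
      rewrite /b -has_predT; apply/hasP; exists (mhash u r a0 x) => //.
      by rewrite mem_filter /g /dict_bucket eqxx map_f.
    by case: (b g) => // ?; rewrite addn0.
  move=> x y xK yK e.
  have [lt|lt|eg] := ltngtP (dict_bucket u r a0 a1 s x) (dict_bucket u r a0 a1 s y).
  - by have := mono _ _ xK yK lt; rewrite e ltnn.
  - by have := mono _ _ yK xK lt; rewrite e ltnn.
  apply: (uniq_map_inj uK1) => //; apply: (uniq_map_inj (seedP (dict_bucket u r a0 a1 s x))).
  - by rewrite mem_filter /dict_bucket eqxx map_f.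
  - by rewrite mem_filter eg /dict_bucket eqxx map_f.
  - by move: e; rewrite /dict_slot -eg => /addnI.
Qed.

(** * Packing fields into the index *)

Definition pack (f : nat) (F : nat -> nat) (t : nat) : nat :=
  \sum_(i < t) F i * 2 ^ (f * i).

Lemma pack_lt f F t : (forall i, i < t -> F i < 2 ^ f) -> pack f F t < 2 ^ (f * t).
Proof.
elim: t => [|t IH] Ff; first by rewrite /pack big_ord0 muln0.
rewrite /pack big_ord_recr /= -/(pack f F t) mulnS expnD.
have lt1 : pack f F t < 2 ^ (f * t) by apply: IH => i it; apply: Ff; apply: ltnW.
have : (F t).+1 * 2 ^ (f * t) <= 2 ^ f * 2 ^ (f * t) by rewrite leq_mul2r Ff ?orbT.
by rewrite mulSn; lia.
Qed.

Lemma field_add f t v u j : j < t ->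
  (v + 2 ^ (f * t) * u) %/ 2 ^ (f * j) %% 2 ^ f = v %/ 2 ^ (f * j) %% 2 ^ f.
Proof.
move=> jt; have -> : f * t = f * j + f + f * (t - j).-1.
  by rewrite -mulnSr -mulnDr; congr (_ * _); lia.
rewrite !expnD addnC; move: (2 ^ (f * (t - j).-1)) => c.
have -> : 2 ^ (f * j) * 2 ^ f * c * u = c * u * 2 ^ f * 2 ^ (f * j) by ring.
by rewrite divnMDl ?expn_gt0 // modnMDl.
Qed.

Lemma pack_field f F t j : (forall i, i < t -> F i < 2 ^ f) -> j < t ->
  pack f F t %/ 2 ^ (f * j) %% 2 ^ f = F j.
Proof.
elim: t => // t IH Ff; rewrite ltnS leq_eqVlt /pack big_ord_recr /= -/(pack f F t).
have Ff' i : i < t -> F i < 2 ^ f by move=> it; apply/Ff/ltnW.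
case/predU1P => [->|jt]; last by rewrite mulnC field_add // IH.
by rewrite addnC divnMDl ?expn_gt0 // divn_small ?pack_lt // addn0 modn_small ?Ff.
Qed.

Lemma bits_sum w v : \sum_(j < w) odd (v %/ 2 ^ j) * 2 ^ j = v %% 2 ^ w.
Proof.
elim: w => [|w IH]; first by rewrite big_ord0 modn1.
rewrite big_ord_recr /= IH expnSr.
have P0 : 0 < 2 ^ w by rewrite expn_gt0.
move: (2 ^ w) P0 => P P0.
have := ltn_pmod v P0; have e := divn_eq v P; have := odd_double_half (v %/ P).
move: (v %/ P) (v %% P) e => q m -> {IH}; case: (odd q) => /= <- lt.
  have -> : (1 + q./2.*2) * P + m = q./2 * (P * 2) + (P + m) by rewrite -muln2; ring.
  by rewrite modnMDl modn_small; lia.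
have -> : (0 + q./2.*2) * P + m = q./2 * (P * 2) + m by rewrite -muln2; ring.
by rewrite modnMDl modn_small; lia.
Qed.

Definition mk_index (w s : nat) (W : nat -> nat) : seq bool :=
  mkseq (fun i => odd (W (i %/ w) %/ 2 ^ (i %% w))) s.

Lemma read_mk_index w s W a : 0 < w -> W a < 2 ^ w -> W a < 2 ^ (s - a * w) ->
  read_index w (mk_index w s W) a = W a.
Proof.
move=> w0 aw as_; rewrite -[RHS](modn_small aw) -bits_sum.
apply: eq_bigr => j _; congr (nat_of_bool _ * _).
have [lt|ge] := ltnP (a * w + j) s.
  by rewrite nth_mkseq // divnMDl // modnMDl (divn_small (ltn_ord j)) addn0 modn_small.
rewrite nth_default ?size_mkseq // divn_small //; apply: leq_trans as_ _.
by rewrite leq_exp2l //; lia.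
Qed.

(* In a short index all fields share the word 0, where the fields of the header
   have [om] bits; in a long one every header field has its own word. *)
Definition header (tau flag : nat) (H : nat -> nat) (i : nat) : nat :=
  match i with 0 => flag | 1 => tau | _ => H i end.

Definition index_layout (w om h t f tau : nat) (H F rd : nat -> nat)
    (rho ob hw : nat) :=
  [/\ [/\ rd 0 != 0, tau <= w, hw <= w & rho <= 1],
     ((rd 0 == 3) && [&& rho == 1, ob == 0 & hw == w]) ||
       ((rd 0 != 3) && [&& rho == 0, ob == om & hw == om]),
     ob * h <= w,
     (forall i, 0 < i < h ->
       rd (rho * i) %/ 2 ^ (ob * i) %% 2 ^ hw = header tau 0 H i) &
     (forall i, i < t ->
       [/\ rho * h + i %/ 2 ^ tau < 2 ^ w,
           ob * h + i %% 2 ^ tau * f <= w &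
           rd (rho * h + i %/ 2 ^ tau) %/ 2 ^ (ob * h + i %% 2 ^ tau * f) %% 2 ^ f
             = F i])].

(** With [tau = om] no field number reaches [2 ^ tau], so the word offset is always 0. As the low
    [om >= 2] bits hold the flag 1, word 0 is neither 0, the sign of an empty index, nor 3, the sign
    of the long format. *)
Lemma short_layout w om h t f H F : 2 <= om -> 1 < h -> 0 < f ->
  om * h + f * t <= w -> t <= 2 ^ om ->
  (forall i, H i < 2 ^ om) -> (forall i, i < t -> F i < 2 ^ f) ->
  exists2 B : seq bool, size B = om * h + f * t &
    index_layout w om h t f om H F (fun a => read_index w B a %% 2 ^ w) 0 om om.
Proof.
move=> om2 h1 f0 fit tom Hom Ff.
have omw : om <= w.
  by apply: leq_trans fit; apply: leq_trans (leq_addr _ _); rewrite leq_pmulr // ltnW.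
have w0 : 0 < w by apply: leq_trans omw; apply: ltnW.
pose Hd := header om 1 H.
have Hdom i : i < h -> Hd i < 2 ^ om.
  move=> _; case: i => [|[|i]] //=; last exact: ltn_expl.
  by rewrite -[X in X < _](expn0 2) ltn_exp2l // ltnW.
pose V := pack om Hd h + 2 ^ (om * h) * pack f F t.
have lt1 := pack_lt Hdom; have lt2 := pack_lt Ff.
have Vlt : V < 2 ^ (om * h + f * t).
  rewrite /V expnD.
  have : 2 ^ (om * h) * (pack f F t).+1 <= 2 ^ (om * h) * 2 ^ (f * t).
    by rewrite leq_mul2l lt2 orbT.
  by rewrite mulnS; lia.
pose W a := if a == 0 then V else 0.
have rd0 : read_index w (mk_index w (om * h + f * t) W) 0 %% 2 ^ w = V.
  have Vw : V < 2 ^ w by apply: leq_trans Vlt _; rewrite leq_exp2l.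
  by rewrite read_mk_index /W ?eqxx ?mul0n ?subn0 // modn_small.
have hd i : i < h -> V %/ 2 ^ (om * i) %% 2 ^ om = Hd i.
  by move=> ih; rewrite /V field_add // pack_field.
have flag : V %% 2 ^ om = 1.
  by have := hd 0 (ltnW h1); rewrite muln0 divn1.
exists (mk_index w (om * h + f * t) W); first by rewrite size_mkseq.
split; rewrite ?mul0n ?rd0.
- split=> //; first by apply: contra_eqN flag => /eqP ->; rewrite mod0n.
- apply/orP; right; rewrite !eqxx !andbT; apply: contra_eqN flag => /eqP ->.
  by rewrite modn_small //; apply: (@leq_trans (2 ^ 2)) => //; rewrite leq_exp2l.
- by apply: leq_trans fit; apply: leq_addr.
- by move=> [|i] // /andP[_ ih]; rewrite mul0n rd0 hd // /Hd; case: (i).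
- move=> i it; have iom := leq_trans it tom.
  rewrite divn_small // modn_small // !addn0 rd0; split.
  + by rewrite expn_gt0.
  + apply: leq_trans fit; rewrite leq_add2l mulnC leq_mul2l; apply/orP; right; exact: ltnW.
  + rewrite expnD divnMA /V addnC [2 ^ _ * pack _ _ _]mulnC divnMDl ?expn_gt0 //.
    by rewrite (divn_small lt1) addn0 [i * f]mulnC pack_field.
Qed.

Lemma long_layout w om h t f H F : 1 < w -> 1 < h -> 0 < f <= w ->
  t + h < 2 ^ w -> (forall i, H i < 2 ^ w) -> (forall i, i < t -> F i < 2 ^ f) ->
  exists B tau, size B <= w * h.+1 + 2 * (f * t) /\
    index_layout w om h t f tau H F (fun a => read_index w B a %% 2 ^ w) 1 0 w.
Proof.
move=> w1 h1 /andP[f0 fw] tw Hw Ff.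
have w0 : 0 < w by apply: ltnW.
(* The number of fields per word is rounded down to a power of two, so that shifts locate a field;
   this wastes less than half of each word. *)
pose tau := trunc_log 2 (w %/ f).
have q0 : 0 < w %/ f by rewrite divn_gt0.
have /andP[le1 lt1] := @trunc_log_bounds 2 (w %/ f) isT q0.
rewrite -/tau in le1 lt1.
have tauf : 2 ^ tau * f <= w by rewrite -leq_divRL.
have wtau : w < 2 * (2 ^ tau * f) by rewrite mulnA -expnS -ltn_divLR.
have T0 : 0 < 2 ^ tau by rewrite expn_gt0.
have tauw : tau <= w.
  apply: leq_trans tauf; apply: leq_trans (ltnW (ltn_expl tau (isT : 1 < 2))) _.
  by rewrite leq_pmulr.
pose Hd := header tau 3 H.
pose F' i := if i < t then F i else 0.
have F'f i : F' i < 2 ^ f by rewrite /F'; case: ifP => [/Ff//|_]; rewrite expn_gt0.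
pose W a := if a < h then Hd a else pack f (fun i => F' ((a - h) * 2 ^ tau + i)) (2 ^ tau).
pose A := h + (t %/ 2 ^ tau).+1.
have Ww a : W a < 2 ^ w.
  rewrite /W; case: ifP => [_|_].
    case: a => [|[|i]] //=; last by apply: leq_ltn_trans tauw (ltn_expl _ _).
    by apply: (@leq_trans (2 ^ 2)) => //; rewrite leq_exp2l.
  apply: leq_trans (pack_lt _) _ => [i _|]; first exact: F'f.
  by rewrite leq_exp2l // mulnC.
have rd a : a < A -> read_index w (mk_index w (w * A) W) a %% 2 ^ w = W a.
  move=> aA; rewrite read_mk_index ?modn_small //.
  apply: leq_trans (Ww a) _; rewrite leq_exp2l // mulnC -mulnBl leq_pmull //.
  by rewrite subn_gt0.
have hA i : i < h -> i < A by move=> ih; apply: leq_trans ih (leq_addr _ _).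
exists (mk_index w (w * A) W), tau; split.
  rewrite size_mkseq /A addnS -addSn mulnDr leq_add2l.
  have := leq_trunc_div t (2 ^ tau); move: (t %/ 2 ^ tau) => q le.
  apply: (@leq_trans (2 * (2 ^ tau * f) * q)); first by rewrite leq_mul2r (ltnW wtau) orbT.
  rewrite -mulnA leq_mul2l /= -mulnA [f * q]mulnC mulnA [2 ^ tau * q]mulnC [f * t]mulnC.
  by rewrite leq_mul2r le orbT.
have W0 : W 0 = 3 by rewrite /W ltnW.
have A0 : 0 < A by rewrite addn_gt0 orbT.
split; rewrite ?mul0n ?(rd _ A0) ?W0 //.
- by rewrite !eqxx.
- move=> i /andP[i0 ih]; rewrite mul0n expn0 divn1 mul1n rd ?hA // modn_small ?Ww //.
  by rewrite /W ih; case: i i0 {ih}.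
- move=> i it; have qA : h + i %/ 2 ^ tau < A by rewrite ltn_add2l ltnS leq_div2r // ltnW.
  rewrite mul1n add0n rd //; split.
  + apply: leq_trans tw; rewrite ltnS addnC leq_add2r.
    by apply: leq_trans (leq_div _ _) (ltnW it).
  + apply: leq_trans tauf; rewrite leq_mul2r; apply/orP; right.
    by apply/ltnW; rewrite ltn_pmod.
  + rewrite /W ltnNge leq_addr /= addKn [_ * f]mulnC pack_field ?ltn_pmod //.
    by rewrite -divn_eq /F' it.
Qed.

(** If the short format does not fit, then [w < om * h + f * t], which pays for [h + 1] full words;
    hence a size bound free of [w]. *)
Lemma exists_layout w om h t f H F : 2 <= om -> 1 < h -> 0 < f <= w ->
  t <= 2 ^ om -> t + h < 2 ^ w ->
  (forall i, H i < 2 ^ om /\ H i < 2 ^ w) -> (forall i, i < t -> F i < 2 ^ f) ->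
  exists B tau rho ob hw, size B <= h.+3 * (om * h + f * t) /\
    index_layout w om h t f tau H F (fun a => read_index w B a %% 2 ^ w) rho ob hw.
Proof.
move=> om2 h1 /andP[f0 fw] tom tw Hlt Ff.
have [fit|nofit] := leqP (om * h + f * t) w.
  have [B sB lB] := short_layout om2 h1 f0 fit tom (fun i => (Hlt i).1) Ff.
  by exists B, om, 0, om, om; split=> //; rewrite sB leq_pmull.
have w1 : 1 < w.
  rewrite -(ltn_exp2l _ _ (isT : 1 < 2)) expn1; apply: leq_ltn_trans tw.
  exact: leq_trans h1 (leq_addl _ _).
have f0w : 0 < f <= w by rewrite f0.
have [B [tau [sB lB]]] := long_layout om w1 h1 f0w tw (fun i => (Hlt i).2) Ff.
exists B, tau, 1, 0, w; split=> //; apply: leq_trans sB _.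
have : w * h.+1 <= (om * h + f * t) * h.+1 by rewrite leq_mul2r (ltnW nofit) orbT.
by rewrite !mulSn [_ * h]mulnC; lia.
Qed.

(** * Heavy prefixes and the table *)

Section Table.
Variables (w : nat) (S : {set word w}).
Local Notation n := #|S|.
Local Notation A := (nth 0 (array S)).
Local Notation rk := (rank_in (array S)).

Definition prefix_of (l x : nat) : nat := x %/ 2 ^ (w - l).
Definition first_rank (l p : nat) : nat := rk (p * 2 ^ (w - l)).
Definition weight (l p : nat) : nat := first_rank l p.+1 - first_rank l p.
Definition size_log : nat := (trunc_log 2 n).+1.
(* The factor [size_log S] makes the dictionary of the heavy prefixes small
   enough for fields of O(log n) bits, and [1 / (l (l + 1))] is summable over all
   lengths [l].  As the search starts at length [m0], about half of [size_log S],
   the logarithm of the threshold at length [l] is O(log l). *)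
Definition threshold (l : nat) : nat := size_log * (l * l.+1).
Definition heavy (l p : nat) : bool := threshold l <= weight l p.

(** A leading 1 records the length, so that prefixes of all lengths become keys of one
    dictionary. *)
Definition code (l p : nat) : nat := 2 ^ l + p.
Definition code_length (k : nat) : nat := trunc_log 2 k.
Definition code_prefix (k : nat) : nat := k - 2 ^ code_length k.
Definition heavy_keys (L : nat) : seq nat :=
  [seq k <- iota 0 (2 ^ L.+1) |
    (0 < code_length k) && heavy (code_length k) (code_prefix k)].

Lemma first_rank_mono l p q : p <= q -> first_rank l p <= first_rank l q.
Proof. by move=> pq; apply: rank_le; rewrite leq_mul2r pq orbT. Qed.

Lemma sum_weight l m : \sum_(p < m) weight l p <= n.
Proof.
suff -> : \sum_(p < m) weight l p = first_rank l m - first_rank l 0.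
  by apply: leq_trans (leq_subr _ _) _; rewrite -size_array rank_size.
elim: m => [|m IH]; first by rewrite big_ord0 subnn.
rewrite big_ord_recr /= IH /weight.
by have := first_rank_mono l (leq0n m); have := first_rank_mono l (leqnSn m); lia.
Qed.

Lemma code_lengthE l p : p < 2 ^ l -> code_length (code l p) = l.
Proof.
by move=> pl; apply: trunc_log_eq => //; rewrite leq_addr /= expnS /code; lia.
Qed.

Lemma code_prefixE l p : p < 2 ^ l -> code_prefix (code l p) = p.
Proof. by move=> pl; rewrite /code_prefix code_lengthE // /code addKn. Qed.

Lemma code_lt l p L : p < 2 ^ l -> l <= L -> code l p < 2 ^ L.+1.
Proof.
move=> pl lL; apply: (@leq_trans (2 ^ l.+1)); last by rewrite leq_exp2l.
by rewrite expnS /code; lia.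
Qed.

Lemma heavy_count l : count (fun p => heavy l p) (iota 0 (2 ^ l)) * threshold l <= n.
Proof.
apply: leq_trans (sum_weight l (2 ^ l)).
rewrite -sum1_count big_mkcond big_distrl /= -(big_mkord xpredT (weight l)).
rewrite /index_iota subn0; apply: leq_sum => p _.
by case: ifP => [hp|_]; rewrite ?mul0n // mul1n.
Qed.

Lemma size_heavy_keys L : size_log * size (heavy_keys L) <= n.
Proof.
(* The sum of [1 / (l * (l + 1))] over lengths up to [L] telescopes to [L / (L + 1)]; this is the
   integer form of the induction. *)
suff h : size_log * size (heavy_keys L) * L.+1 <= n * L.
  by rewrite -(leq_pmul2r (ltn0Sn L)) (leq_trans h) // leq_mul2l leqnSn orbT.
have -> : size (heavy_keys L) = count (fun k => (0 < code_length k) &&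
    heavy (code_length k) (code_prefix k)) (iota 0 (2 ^ L.+1)).
  by rewrite size_filter.
elim: L => [|L IH].
  by rewrite expn1 /= !addn0 !muln0.
rewrite expnS mul2n -addnn iotaD count_cat add0n.
set X := count _ _ in IH *; set Y := count _ _.
have YE : Y = count (fun p => heavy L.+1 p) (iota 0 (2 ^ L.+1)).
  rewrite /Y -{1}[2 ^ L.+1]addn0 iotaDl count_map; apply: eq_in_count => p.
  rewrite mem_iota add0n /= => pl.
  by rewrite -/(code L.+1 p) code_lengthE // code_prefixE.
have := heavy_count L.+1; rewrite -YE /threshold => hY.
rewrite -(leq_pmul2r (ltn0Sn L)).
have -> : size_log * (X + Y) * L.+2 * L.+1 =
  (size_log * X * L.+1) * L.+2 + Y * (size_log * (L.+1 * L.+2)) by ring.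
apply: leq_trans (leq_add (leq_mul IH (leqnn _)) hY) _.
by rewrite -mulnA -[X in _ + X]muln1 -mulnDr -mulnA leq_mul2l; apply/orP; right; lia.
Qed.

Lemma prefix_lt l x : l <= w -> x < 2 ^ w -> prefix_of l x < 2 ^ l.
Proof. by move=> lw xw; rewrite ltn_divLR ?expn_gt0 // -expnD subnKC. Qed.

Lemma prefix_bounds l x :
  prefix_of l x * 2 ^ (w - l) <= x < (prefix_of l x).+1 * 2 ^ (w - l).
Proof. by rewrite leq_trunc_div /= ltn_ceil ?expn_gt0. Qed.

Lemma rank_prefix l x :
  first_rank l (prefix_of l x) <= rk x <= first_rank l (prefix_of l x).+1.
Proof.
by have /andP[h1 h2] := prefix_bounds l x; rewrite !rank_le // ltnW.
Qed.

Lemma prefix_of_array l p i : first_rank l p <= i < first_rank l p.+1 ->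
  prefix_of l (A i) = p.
Proof.
move=> /andP[h1 h2].
have iN : i < n by apply: leq_trans h2 _; rewrite -size_array rank_size.
have lt : A i < p.+1 * 2 ^ (w - l) by rewrite array_lt_rank.
have ge : p * 2 ^ (w - l) <= A i by rewrite leqNgt array_lt_rank // -leqNgt.
apply/eqP; rewrite eqn_leq; apply/andP; split.
  by rewrite -ltnS ltn_divLR ?expn_gt0.
by rewrite leq_divRL ?expn_gt0.
Qed.

Lemma heavy_index l p : 0 < l -> heavy l p ->
  first_rank l p < first_rank l p.+1.
Proof.
move=> l0; rewrite /heavy /threshold /weight => h.
by rewrite -subn_gt0; apply: leq_trans h; rewrite !muln_gt0 l0.
Qed.

Lemma weight_le l p : weight l p <= 2 ^ (w - l).
Proof.
rewrite /weight /first_rank mulSn leq_subLR addnC addnC [2 ^ _ + _]addnC.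
exact: rank_window (uniq_array S).
Qed.

Lemma size_log_gt : n < 2 ^ size_log.
Proof. exact: trunc_log_ltn. Qed.

End Table.

(** * Contents and size of the table *)

Section Spec.
Variables (w : nat) (S : {set word w}).
Local Notation n := #|S|.
Local Notation A := (nth 0 (array S)).
Local Notation nu := (size_log S).
Local Notation m0 := (nu./2).

(** The cap [n] keeps codes and their multiplier within the [n + 1] bits of a short header field;
    the cap [w - 1] makes every code a word. *)
Definition max_length : nat := minn n w.-1.
Definition field_size : nat := minn w (2 * nu).+1.
(** Clamping makes every bound an array position that fits into a field. Nothing is lost, since the
    program has dealt with rank [n] before it reads the table. *)
Definition clamped_rank (l p : nat) : nat := minn (first_rank S l p) n.-1.

Section Fields.
Variables (r s a0 a1 : nat) (F : nat -> nat).
Definition bucket_field (k : nat) : nat :=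
  3 * (2 ^ m0 + mhash r s a1 (mhash max_length.+1 r a0 k)).
Definition slot_field (k : nat) : nat :=
  let b := bucket_field k in
  3 * (F b.+1 + mhash r (F b.+2) (F b) (mhash max_length.+1 r a0 k)).
End Fields.

(* The fields [3 e], [3 e + 1], [3 e + 2] form the entry [e].  The first
   [2 ^ m0] entries are indexed by the prefixes of length [m0], the next
   [2 ^ s] are the buckets and the remaining ones the slots of a dictionary of
   the heavy prefixes. *)
Definition table_spec (r s a0 a1 t : nat) (F : nat -> nat) : Prop :=
  [/\ [/\ a0 < 2 ^ max_length.+1, a1 < 2 ^ r, s <= r & r <= max_length.+1],
   (forall y, y < 2 ^ m0 -> [/\ (3 * y).+1 < t,
      F (3 * y) = clamped_rank m0 y & F (3 * y).+1 = clamped_rank m0 y.+1]),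
   (forall k, k < 2 ^ max_length.+1 ->
      [/\ (bucket_field r s a0 a1 k).+2 < t, F (bucket_field r s a0 a1 k).+2 <= r
        & (slot_field r s a0 a1 F k).+2 < t]) &
   (forall q x, 0 < q <= max_length -> x < 2 ^ w ->
      let e := slot_field r s a0 a1 F (code q (prefix_of w q x)) in
      (F e.+2 = q -> prefix_of w q (A (F e)) = prefix_of w q x ->
         [/\ first_rank S q (prefix_of w q x) < n,
         F e = first_rank S q (prefix_of w q x) &
         F e.+1 = clamped_rank q (prefix_of w q x).+1]) /\
      (heavy S q (prefix_of w q x) ->
         F e.+2 = q /\ prefix_of w q (A (F e)) = prefix_of w q x))].

Lemma double_lt_exp k : 5 <= k -> (2 * k).+1 <= 2 ^ k.-1.
Proof.
elim: k => // k IH; rewrite leq_eqVlt => /predU1P[<-//|k5].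
have := IH k5; case: k {IH} k5 => // k _ /=; rewrite expnS; lia.
Qed.

Hypothesis nu_big : 128 <= nu.

Lemma n_gt0 : 0 < n.
Proof.
by case: (posnP n) => // n0; move: nu_big; rewrite /size_log n0 trunc_log0.
Qed.

Lemma exp_nu_le : 2 ^ nu.-1 <= n.
Proof. exact: trunc_logP n_gt0. Qed.

Lemma nu_le_w : nu.-1 <= w.
Proof.
by rewrite -(leq_exp2l _ _ (isT : 1 < 2)) (leq_trans exp_nu_le) // card_le_words.
Qed.

(** This is why the direct table uses only half of the [nu] bits: its entries have O(nu) bits each
    and must total O(n). *)
Lemma nu_exp_half : 2 ^ m0 * nu <= n.
Proof.
apply: leq_trans exp_nu_le.
have m5 : 5 <= m0 by have := half_leq nu_big; lia.
have := double_lt_exp m5 => h.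
have : nu <= 2 ^ m0.-1 by apply: leq_trans h; have := odd_double_half nu; lia.
move=> h2; apply: leq_trans (leq_mul (leqnn _) h2) _.
by rewrite -expnD leq_exp2l //; have := odd_double_half nu; lia.
Qed.

Lemma nu_le_n : nu <= n.
Proof. by apply: leq_trans nu_exp_half; rewrite leq_pmull // expn_gt0. Qed.

Lemma pred_n_lt : n.-1 < 2 ^ field_size.
Proof.
have lt1 : n.-1 < 2 ^ w by have := n_gt0; have := card_le_words S; lia.
rewrite /field_size; case: (leqP w) => // _; rewrite prednK ?n_gt0 //.
by apply: leq_trans (ltnW (size_log_gt S)) _; rewrite leq_exp2l //; lia.
Qed.

Lemma code_length_le k L : k < 2 ^ L.+1 -> code_length k <= L.
Proof.
have [->|k0] := posnP k; first by rewrite /code_length trunc_log0.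
move=> kL; rewrite -ltnS -(ltn_exp2l _ _ (isT : 1 < 2)).
exact: leq_ltn_trans (trunc_logP (isT : 1 < 2) k0) kL.
Qed.

Lemma exists_table : exists r s a0 a1 t F,
  [/\ table_spec r s a0 a1 t F, nu * t <= 51 * n &
      forall i, i < t -> F i < 2 ^ field_size].
Proof.
pose L := max_length; pose u := L.+1; pose K := heavy_keys S L; pose N := size K.
pose r := minn u (2 * nu).+1.
have w2 : 126 < w by have := nu_le_w; lia.
have uw : u <= w by rewrite /u /L /max_length; have := geq_minr n w.-1; lia.
have rf : r <= field_size.
  by rewrite /r /field_size leq_min geq_minr andbT (leq_trans (geq_minl _ _)).
have r0 : 0 < r <= u by rewrite geq_minl andbT leq_min.
have uK : uniq K by apply: filter_uniq; apply: iota_uniq.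
have Ku k : k \in K -> k < 2 ^ u by rewrite mem_filter mem_iota add0n => /andP[_].
have NK : nu * N <= n by apply: size_heavy_keys.
(* [N <= n < 2 ^ nu], so [2 * nu + 1] bits suffice for an injective hash. *)
have fits : 2 * N ^ 2 < 2 ^ r \/ r = u.
  rewrite /r; case: (leqP u) => _; first by right.
  left; rewrite [2 ^ _.+1]expnS ltn_pmul2l // [2 * nu]mulnC expnM ltn_exp2r //.
  apply: leq_ltn_trans (size_log_gt S); apply: leq_trans NK.
  by rewrite leq_pmull.
have [a0 [a1 [s [seed [off [rb [[a0u a1r sr s2] bk inj]]]]]]] :=
  exists_dictionary (isT : 0 < u) r0 uK Ku fits.
rewrite -/N in s2 bk.
pose base := 2 ^ m0 + 2 ^ s; pose E := base + (12 * N).+1; pose t := 3 * E.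
(* There are at most [2 ^ m0 + (2 N + 1) + (12 N + 1)] entries; times [nu] this is at most
   [(1 + 3 + 13) n], and each entry has 3 fields. *)
have nut : nu * t <= 51 * n.
  have := nu_exp_half; have := nu_le_n.
  have : nu * 2 ^ s <= nu * (2 * N + 1) by rewrite leq_mul2l s2 orbT.
  by rewrite /t /E /base; lia.
have tn : t < n by have := n_gt0; move: nut nu_big; nia.
have tlt i : i <= t -> i < 2 ^ field_size.
  move=> it; apply: leq_ltn_trans pred_n_lt; apply: leq_trans it _.
  by have := n_gt0; lia.
pose slot := dict_slot u r a0 a1 s seed off rb.
(* In a slot without a key the default 0 has length 0, which differs from every probed length, so
   the slot reports failure. *)
pose found e := nth 0 K (find (fun k => slot k == e - base) K).
pose tbl e j :=
  if e < 2 ^ m0 then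
    match j with 0 => clamped_rank m0 e | 1 => clamped_rank m0 e.+1 | _ => 0 end
  else if e < base then
    let g := e - 2 ^ m0 in
    match j with 0 => seed g | 1 => base + off g | _ => rb g end
  else
    let l := code_length (found e) in let p := code_prefix (found e) in
    match j with 0 => clamped_rank l p | 1 => clamped_rank l p.+1 | _ => l end.
pose F i := tbl (i %/ 3) (i %% 3).
have F0 e : F (3 * e) = tbl e 0 by rewrite /F mulKn // modnMr.
have F1 e : F (3 * e).+1 = tbl e 1.
  by rewrite /F -addn1 mulnC divnMDl // modnMDl addn0.
have F2 e : F (3 * e).+2 = tbl e 2.
  by rewrite /F -addn2 mulnC divnMDl // modnMDl addn0.
have clt l p : clamped_rank l p < 2 ^ field_size.
  by apply: leq_ltn_trans pred_n_lt; apply: geq_minr.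
exists r, s, a0, a1, t, F.
have bucketE k : bucket_field r s a0 a1 k = 3 * (2 ^ m0 + dict_bucket u r a0 a1 s k).
  by [].
have gs k : dict_bucket u r a0 a1 s k < 2 ^ s by apply: mhash_lt.
have tbl_bucket k : let e := 2 ^ m0 + dict_bucket u r a0 a1 s k in
    [/\ tbl e 0 = seed (dict_bucket u r a0 a1 s k),
        tbl e 1 = base + off (dict_bucket u r a0 a1 s k) &
        tbl e 2 = rb (dict_bucket u r a0 a1 s k)].
  move=> e; rewrite /tbl ltnNge leq_addr /= /e ltn_add2l gs.
  by rewrite addKn.
have slotE k : slot_field r s a0 a1 F k = 3 * (base + slot k).
  have [e0 e1 e2] := tbl_bucket k.
  by rewrite /slot_field !bucketE F0 F1 F2 e0 e1 e2 -addnA.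
have slot_lt k : slot k < 12 * N + 1.
  have [_ rbr le] := bk _ (gs k); apply: leq_trans le.
  by rewrite /slot /dict_slot ltn_add2l mhash_lt.
split=> //; last first.
  move=> i it; rewrite /F; set e := i %/ 3.
  have eE : e < E by rewrite ltn_divLR // mulnC.
  rewrite /tbl; case: ifP => [_|e1].
    by case: (i %% 3) => [|[|j]]; rewrite ?clt // expn_gt0.
  case: ifP => [e2|e2].
    have gl : e - 2 ^ m0 < 2 ^ s by move: e1 e2; rewrite /base; lia.
    have [sl rl ol] := bk _ gl.
    case: (i %% 3) => [|[|j]].
    - by apply: leq_trans sl _; rewrite leq_exp2l.
    - by apply: tlt; rewrite /t /E; lia.
    - by apply: leq_ltn_trans rl _; apply: leq_ltn_trans rf (ltn_expl _ _).
  case: (i %% 3) => [|[|j]]; rewrite ?clt //.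
  apply: (@leq_ltn_trans L).
    rewrite code_length_le // /found.
    have [lt|ge] := ltnP (find (fun k => slot k == e - base) K) (size K).
      by apply: Ku; apply: mem_nth.
    by rewrite nth_default // expn_gt0.
  have Lw : L < 2 ^ w by apply: leq_ltn_trans (ltn_expl w _) => //; apply: ltnW.
  rewrite /field_size; case: (leqP w) => // _.
  apply: leq_ltn_trans (geq_minl n _) _; apply: leq_trans (size_log_gt S) _.
  by rewrite leq_exp2l //; lia.
split=> //; first by case/andP: r0.
- move=> y ym; rewrite F0 F1 /tbl ym; split=> //.
  by rewrite /t /E /base; lia.
- move=> k ku; have [_ _ e2] := tbl_bucket k.
  have [_ rbr _] := bk _ (gs k).
  rewrite slotE !bucketE F2 e2; split=> //.
    by have := gs k; rewrite /t /E /base; lia.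
  by have := slot_lt k; rewrite /t /E; lia.
- move=> q x /andP[q0 qL] xw; set p := prefix_of w q x.
  have qw : q <= w by apply: leq_trans qL (leq_trans (leqnSn _) uw).
  have pq : p < 2 ^ q by apply: prefix_lt.
  cbv zeta; rewrite slotE F0 F1 F2; set e := base + slot (code q p).
  have -> : tbl e 0 = clamped_rank (code_length (found e)) (code_prefix (found e)).
    by rewrite /tbl /e ltnNge -addnA leq_addr /= addnA ltnNge leq_addr.
  have -> : tbl e 1 = clamped_rank (code_length (found e)) (code_prefix (found e)).+1.
    by rewrite /tbl /e ltnNge -addnA leq_addr /= addnA ltnNge leq_addr.
  have -> : tbl e 2 = code_length (found e).
    by rewrite /tbl /e ltnNge -addnA leq_addr /= addnA ltnNge leq_addr.
  have key_ok k : k \in K -> code_length k = q ->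
      [/\ first_rank S q (code_prefix k) < n,
        clamped_rank q (code_prefix k) = first_rank S q (code_prefix k) &
        prefix_of w q (A (first_rank S q (code_prefix k))) = code_prefix k].
    rewrite mem_filter => /andP[/andP[_ hk] _] lq; rewrite lq in hk.
    have lt := heavy_index q0 hk.
    have ltn : first_rank S q (code_prefix k) < n.
      by apply: leq_trans lt _; rewrite -size_array rank_size.
    split=> //; first by rewrite /clamped_rank; apply/minn_idPl; lia.
    by apply: prefix_of_array; rewrite leqnn.
  split=> [lq|hp].
    have fK : found e \in K.
      rewrite /found; have [lt|ge] := ltnP (find (fun k => slot k == e - base) K) (size K).
        exact: mem_nth.
      by move: q0; rewrite -lq /found nth_default // /code_length trunc_log0.
    have [k1 k2 k3] := key_ok _ fK lq.
    by rewrite lq k2 k3 => <-; split.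
  have kK : code q p \in K.
    by rewrite mem_filter mem_iota code_lengthE // code_prefixE // q0 hp /= add0n code_lt.
  have fe : found e = code q p.
    have hs : has (fun k => slot k == e - base) K.
      by apply/hasP; exists (code q p) => //; rewrite /e addKn.
    have := nth_find 0 hs; rewrite -/(found e) /e addKn => /eqP /inj; apply=> //.
    by rewrite /found mem_nth // -has_find.
  have [k1 k2 k3] := key_ok _ kK (code_lengthE pq).
  by rewrite fe code_lengthE // k2 k3 code_prefixE.
Qed.

End Spec.

(** * The query program *)

Fixpoint loop_free (p : program) : bool :=
  match p with
  | Basic _ => true
  | Seq p q | If _ p q => loop_free p && loop_free q
  | While _ _ => false
  end.

Fixpoint max_time (p : program) : nat :=
  match p with
  | Basic _ => 1
  | Seq p q => max_time p + max_time q
  | If _ p q => (maxn (max_time p) (max_time q)).+1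
  | While _ _ => 0
  end.

Section Verification.
Variables (w : nat) (S : {set word w}) (h : hash_family w) (B : seq bool).

Lemma exec_max_time p s t s' : loop_free p -> exec S h B p s t s' -> t <= max_time p.
Proof.
move=> lf e; elim: e lf => //=.
- by move=> ??????? _ IH1 _ IH2 /andP[/IH1 ? /IH2 ?]; apply: leq_add.
- by move=> ?????? _ _ IH /andP[/IH ? _]; rewrite ltnS leq_max; apply/orP; left.
- by move=> ?????? _ _ IH /andP[_ /IH ?]; rewrite ltnS leq_max; apply/orP; right.
Qed.

(* Time need not be tracked inside loop-free code: see [ht_hp]. *)
Definition hp (p : program) (r : env) (Q : env -> Prop) : Prop :=
  forall s, agree s r -> exists t s' r',
    [/\ exec S h B p s t s', agree s' r' & Q r'].

Lemma ht_hp p r Q : loop_free p -> hp p r Q -> ht S h B p r (max_time p) Q.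
Proof.
move=> lf hpr s /hpr[t [s' [r' [e a q]]]]; exists t, s', r'; split=> //.
exact: exec_max_time e.
Qed.

Lemma hp_ht p r T Q : ht S h B p r T Q -> hp p r Q.
Proof. by move=> H s /H[t [s' [r' [e _ a q]]]]; exists t, s', r'. Qed.

Lemma hp_conseq p r (Q Q' : env -> Prop) :
  hp p r Q -> (forall r', Q r' -> Q' r') -> hp p r Q'.
Proof.
by move=> H QQ s /H[t [s' [r' [e a q]]]]; exists t, s', r'; split=> //; apply: QQ.
Qed.

Lemma hp_asg v e r (Q : env -> Prop) : vok e -> v < nvars ->
  Q (upd r v (evn S B e r)) -> hp (asg v e) r Q.
Proof.
move=> ve vv q.
exact: hp_ht (@ht_asg w S h B v e r (cost e + 1) Q ve vv (leqnn _) q).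
Qed.

Lemma hp_set v e r k (Q : env -> Prop) : vok e -> v < nvars ->
  evn S B e r = k -> Q (upd r v k) -> hp (asg v e) r Q.
Proof. by move=> ve vv <-; apply: hp_asg. Qed.

Lemma hp_seq p q r (Q : env -> Prop) :
  hp p r (fun r1 => hp q r1 Q) -> hp (Seq p q) r Q.
Proof.
move=> H s /H[t [s' [r' [e a /(_ _ a)[t2 [s2 [r2 [e2 a2 q2]]]]]]]].
by exists (t + t2), s2, r2; split=> //; apply: exec_seq e e2.
Qed.

Lemma hp_if e p q r (Q : env -> Prop) : vok e ->
  (evn S B e r != 0 -> hp p r Q) -> (evn S B e r = 0 -> hp q r Q) ->
  hp (cif e p q) r Q.
Proof.
move=> ve hp1 hp2 s /(exec_comp_nvars S h B ve)[s1 [x1 r1 a1]].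
have [e0|e0] := eqVneq (evn S B e r) 0.
  have [t2 [s2 [r2 [x2 a2 q2]]]] := hp2 e0 s1 a1.
  exists (cost e + t2.+1), s2, r2; split=> //.
  by apply: exec_seq x1 _; apply: exec_if_false; rewrite // r1.
have [t2 [s2 [r2 [x2 a2 q2]]]] := hp1 e0 s1 a1.
exists (cost e + t2.+1), s2, r2; split=> //.
by apply: exec_seq x1 _; apply: exec_if_true; rewrite // r1.
Qed.

Local Notation P := (2 ^ w).
Local Notation ev := (evn S B).

Lemma ev_const k r : k < P -> ev (EC k) r = k.
Proof. exact: modn_small. Qed.

Lemma ev_add e1 e2 r a b : ev e1 r = a -> ev e2 r = b -> a + b < P ->
  ev (EB Add e1 e2) r = a + b.
Proof. by move=> /= -> ->; apply: modn_small. Qed.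

Lemma ev_sub e1 e2 r a b : ev e1 r = a -> ev e2 r = b -> b <= a -> a < P ->
  ev (EB Defs.Sub e1 e2) r = a - b.
Proof.
move=> /= -> -> ba aP; have -> : a + (P - b) = a - b + P by lia.
by rewrite modnDr modn_small //; lia.
Qed.

Lemma ev_mul e1 e2 r a b : ev e1 r = a -> ev e2 r = b -> a * b < P ->
  ev (EB Mul e1 e2) r = a * b.
Proof. by move=> /= -> ->; apply: modn_small. Qed.

Lemma ev_shl e1 e2 r a b : ev e1 r = a -> ev e2 r = b ->
  ev (EB Shl e1 e2) r = a * 2 ^ b %% P.
Proof. by move=> /= -> ->. Qed.

Lemma ev_shr e1 e2 r a b : ev e1 r = a -> ev e2 r = b -> a < P ->
  ev (EB Shr e1 e2) r = a %/ 2 ^ b.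
Proof.
by move=> /= -> -> aP; apply: modn_small; apply: leq_ltn_trans (leq_div _ _) aP.
Qed.

Lemma ev_array e r a : ev e r = a -> ev (ES e) r = nth 0 (array S) a.
Proof. by move=> /= ->. Qed.

Lemma ev_index e r a : ev e r = a -> ev (EI e) r = read_index w B a %% P.
Proof. by move=> /= ->. Qed.

Lemma ev_ltn e1 e2 r a b : 0 < w -> ev e1 r = a -> ev e2 r = b ->
  ev (EB Ltn e1 e2) r = (a < b).
Proof.
move=> w0 /= -> ->; apply: modn_small; apply: leq_ltn_trans (leq_b1 _) _.
by rewrite -[X in X < _](expn0 2) ltn_exp2l.
Qed.

Lemma ev_eqn e1 e2 r a b : 0 < w -> ev e1 r = a -> ev e2 r = b ->
  ev (EB Eqn e1 e2) r = (a == b).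
Proof.
move=> w0 /= -> ->; apply: modn_small; apply: leq_ltn_trans (leq_b1 _) _.
by rewrite -[X in X < _](expn0 2) ltn_exp2l.
Qed.

End Verification.

Arguments hp_set {w S h B v e r k Q}.

(* Registers: 0 query, 1 word size, 2 last array index; 3 and 4 bounds [a, b] on
   the rank of the query; 5 galloping step; 6 midpoint; 9 the length m0 of the
   prefixes that index the table directly; 10, 11, 12 geometry of the header;
   13 to 20 the header fields tau, nu, L, r, s, a0, a1, f; 21 and 22 word and bit
   position of the first table field; 23 and 24 bounds on the prefix length;
   25 length to be probed; 26 and 27 bounds read from the table; 28 to 35
   temporaries of a lookup, 35 holding its success. *)
Definition vX := EV 0.
Definition vW := EV 1.
Definition vN := EV 2.
Definition vA := EV 3.
Definition vB := EV 4.
Definition vD := EV 5.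
Definition vM := EV 6.

(** The [k] low bits of [e]: the left shift drops the others from the word. *)
Definition low (e k : expr) : expr :=
  EB Shr (EB Shl e (EB Defs.Sub vW k)) (EB Defs.Sub vW k).

Definition half_gap : expr := EB Shr (EB Defs.Sub vB vA) (EC 1).

Definition gallop_body : program :=
  cif (EB Ltn (ES (EB Add vA vD)) vX)
    (cif (EB Ltn (ES (EB Defs.Sub (EB Defs.Sub vB vD) (EC 1))) vX)
       (asg 3 (EB Defs.Sub vB vD))
       (asg 5 (EB Add vD vD)))
    (asg 4 (EB Add vA vD)).
Definition gallop : program := cwhile (EB Ltn vD half_gap) gallop_body.

Definition bisect_body : program :=
  Seq (asg 6 (EB Add vA half_gap))
    (cif (EB Ltn (ES vM) vX) (asg 3 (EB Add vM (EC 1))) (asg 4 vM)).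
Definition bisect : program := cwhile (EB Ltn vA vB) bisect_body.

(** * Galloping and bisection *)

Section Search.
Variables (w : nat) (S : {set word w}) (h : hash_family w) (B : seq bool).
Variable x : nat.
Hypotheses (w0 : 0 < w) (S0 : S != set0) (xP : x < 2 ^ w).
Local Notation n := #|S|.
Local Notation A := (nth 0 (array S)).
Local Notation rk := (rank_in (array S)).
Local Notation P := (2 ^ w).
Local Notation ev := (evn S B).

Definition bracket (r : env) : Prop :=
  [/\ r 0 = x, r 1 = w, r 3 <= rk x, rk x <= r 4 & r 4 < n].

Lemma one_lt : 1 < P.
Proof. by rewrite -[X in X < _](expn0 2) ltn_exp2l. Qed.

Lemma ev_half_gap r : bracket r -> ev half_gap r = (r 4 - r 3) %/ 2.
Proof.
move=> [_ _ h1 h2 h3]; have nP := card_le_words S.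
rewrite (@ev_shr _ _ _ _ _ _ (r 4 - r 3) 1) ?expn1 //; last lia.
  by apply: ev_sub => //; lia.
by apply: ev_const; apply: one_lt.
Qed.

(** If both tests of a round fail, the rank is more than [d] away from both ends, so [d] is below
    [2 ^ m] before each doubling. A success leaves a gap of exactly [d], which ends the loop. *)
Lemma gallop_ok m z : bracket z -> minn (rk x - z 3) (z 4 - rk x) <= 2 ^ m ->
  z 5 = 1 ->
  ht S h B gallop z (m.+3 * (max_time gallop_body + cost (EB Ltn vD half_gap) + 1))
    (fun r' => bracket r' /\ r' 4 - r' 3 < 2 ^ m.+3).
Proof.
move=> br le d1.
(* In the first alternative the loop is about to end; in the second, [k - 1] more doublings would
   bring [d] above [2 ^ m]. *)
pose I k (r : env) := [/\ bracket r, 1 <= r 5, r 5 <= 2 ^ m.+1 &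
  r 4 - r 3 <= 2 * r 5 + 1 \/
  [/\ minn (rk x - r 3) (r 4 - rk x) <= 2 ^ m, 0 < k & 2 ^ m < r 5 * 2 ^ k.-1]].
apply: (@ht_while _ S h B _ _ I _ _ _ _ _ m.+2) => //.
- move=> k r [{}br d0 dm hk].
  rewrite (@ev_ltn _ _ _ _ _ _ (r 5) ((r 4 - r 3) %/ 2)) //; last exact: ev_half_gap.
  move=> c; split=> //; rewrite !expnS in dm *.
  have : (r 4 - r 3) %/ 2 <= r 5 by case: leqP c.
  have := expn_gt0 2 m; lia.
- move=> k r [{}br d0 dm hk].
  rewrite (@ev_ltn _ _ _ _ _ _ (r 5) ((r 4 - r 3) %/ 2)) //; last exact: ev_half_gap.
  case: ltnP => // lt _.
  have {hk} far : [/\ minn (rk x - r 3) (r 4 - rk x) <= 2 ^ m, 0 < k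
      & 2 ^ m < r 5 * 2 ^ k.-1] by case: hk => //; move: lt; clear; lia.
  have k1 : k.-1 < k by case: far => _ k0 _; rewrite prednK.
  have [rx rw ra rb rn] := br.
  have nP := card_le_words S.
  have ead : ev (EB Add vA vD) r = r 3 + r 5 by apply: ev_add => //; lia.
  have ebd : ev (EB Defs.Sub vB vD) r = r 4 - r 5 by apply: ev_sub => //; lia.
  have ebd1 : ev (EB Defs.Sub (EB Defs.Sub vB vD) (EC 1)) r = r 4 - r 5 - 1.
    by apply: ev_sub ebd _ _ _; rewrite ?ev_const ?one_lt //; lia.
  apply: ht_hp => //; apply: hp_if => //.
  + rewrite (@ev_ltn _ _ _ _ _ _ (A (r 3 + r 5)) x) //; last exact: ev_array ead.
    rewrite array_lt_rank; last lia.
    case: ltnP => // lt1 _; apply: hp_if => //.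
    * rewrite (@ev_ltn _ _ _ _ _ _ (A (r 4 - r 5 - 1)) x) //; last exact: ev_array ebd1.
      rewrite array_lt_rank; last lia.
      case: ltnP => // lt2 _; apply: (hp_set _ _ ebd) => //.
      exists k.-1 => //.
      split=> //; rewrite /upd /=; last by left; lia.
      by split=> //=; lia.
    * rewrite (@ev_ltn _ _ _ _ _ _ (A (r 4 - r 5 - 1)) x) //; last exact: ev_array ebd1.
      rewrite array_lt_rank; last lia.
      case: ltnP => // lt2 _.
      apply: (@hp_set _ _ _ _ _ _ _ (r 5 + r 5)) => //; first by apply: ev_add => //; lia.
      have [hm k0 hk] := far.
      have k2 : 1 < k.
        by case: k k0 hk {k1 far} => // -[|k] // _; rewrite muln1; lia.
      exists k.-1 => //.
      split=> //; rewrite /upd /=; [lia|rewrite expnS; lia|right].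
      split=> //; first lia.
      by case: k k2 hk {k0 k1 far} => // -[|k] //= _; rewrite expnS; lia.
  + rewrite (@ev_ltn _ _ _ _ _ _ (A (r 3 + r 5)) x) //; last exact: ev_array ead.
    rewrite array_lt_rank; last lia.
    case: ltnP => // le1 _; apply: (hp_set _ _ ead) => //.
    exists k.-1 => //.
    split=> //; rewrite /upd /=; last by left; lia.
    by split=> //=; apply: leq_ltn_trans rn; lia.
- split=> //; rewrite d1 ?expn_gt0 //; right; split=> //=.
  by rewrite mul1n ltn_exp2l.
Qed.

Lemma bisect_ok m z : bracket z -> z 4 - z 3 < 2 ^ m ->
  ht S h B bisect z (m.+1 * (max_time bisect_body + cost (EB Ltn vA vB) + 1))
    (fun r => r 3 = rk x).
Proof.
move=> bz gap.
apply: (@ht_while _ S h B _ _ (fun k r => bracket r /\ r 4 - r 3 < 2 ^ k)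
  _ _ _ _ _ m) => //.
- move=> k r [[_ _ h1 h2 _] _]; rewrite (@ev_ltn _ _ _ _ _ _ (r 3) (r 4)) //.
  by case: ltnP => // ? _; lia.
- move=> k r [br gp]; rewrite (@ev_ltn _ _ _ _ _ _ (r 3) (r 4)) //.
  case: ltnP => // lt _; have [rx rw ra rb rn] := br; have nP := card_le_words S.
  have k0 : 0 < k by case: k gp => //; rewrite expn0; lia.
  have e2 : 2 ^ k = 2 * 2 ^ k.-1 by rewrite -expnS prednK.
  set mid := r 3 + (r 4 - r 3) %/ 2.
  have midb : mid < r 4 by rewrite /mid; lia.
  have emid : ev (EB Add vA half_gap) r = mid.
    apply: ev_add; [by []|exact: ev_half_gap|by rewrite -/mid; lia].
  apply: ht_hp => //; apply: hp_seq; apply: (hp_set _ _ emid) => //.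
  apply: hp_if => //;
    rewrite (@ev_ltn _ _ _ _ _ _ (A mid) x) ?array_lt_rank //;
    try (by lia); case: ltnP => // cmp _.
  + apply: (@hp_set _ _ _ _ _ _ _ mid.+1) => //.
      rewrite (@ev_add _ _ _ _ _ _ mid 1) ?addn1 //; first by apply: ev_const; apply: one_lt.
      by apply: leq_trans nP; lia.
    exists k.-1; first lia.
    by split; rewrite /upd /=; [split=> //=; lia|rewrite /mid in cmp *; lia].
  + apply: (@hp_set _ _ _ _ _ _ _ mid) => //.
    exists k.-1; first lia.
    by split; rewrite /upd /=; [split=> //=; exact: ltn_trans midb rn|rewrite /mid; lia].
Qed.

End Search.

Definition hsh (ea ek eu er : expr) : expr :=
  EB Shr (EB Shl (EB Mul ea ek) (EB Defs.Sub vW eu)) (EB Defs.Sub vW er).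

Definition hfield (i : nat) : expr :=
  low (EB Shr (EI (EB Mul (EV 10) (EC i))) (EB Mul (EV 11) (EC i))) (EV 12).

Definition fetch (e : expr) : expr :=
  low (EB Shr (EI (EB Add (EV 21) (EB Shr e (EV 13))))
              (EB Add (EV 22) (EB Mul (low e (EV 13)) (EV 20)))) (EV 20).

Definition plus (e : expr) (k : nat) : expr := EB Add e (EC k).
Definition prefix_expr (q : expr) : expr := EB Shr vX (EB Defs.Sub vW q).

(** The range read from the table contains the rank. Comparing [x] with its two extreme elements
    shows that the rank is strictly inside or else determines it, and then [a = b] ends the
    search. *)
Definition apply_range : program :=
  cif (EB Ltn (ES (EV 26)) vX)
    (cif (EB Ltn (ES (EB Defs.Sub (EV 27) (EC 1))) vX)
      (Seq (asg 3 (EV 27)) (asg 4 (EV 27)))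
      (Seq (asg 3 (EV 26)) (asg 4 (EV 27))))
    (Seq (asg 3 (EV 26)) (asg 4 (EV 26))).

Definition probe : program :=
  Seq (asg 28 (EB Add (EB Shl (EC 1) (EV 25)) (prefix_expr (EV 25))))
  (Seq (asg 28 (hsh (EV 18) (EV 28) (plus (EV 15) 1) (EV 16)))
  (Seq (asg 29 (EB Mul (EC 3) (EB Add (EB Shl (EC 1) (EV 9))
                                      (hsh (EV 19) (EV 28) (EV 16) (EV 17)))))
  (Seq (asg 30 (fetch (EV 29)))
  (Seq (asg 31 (fetch (plus (EV 29) 1)))
  (Seq (asg 32 (fetch (plus (EV 29) 2)))
  (Seq (asg 33 (EB Mul (EC 3)
                  (EB Add (EV 31) (hsh (EV 30) (EV 28) (EV 16) (EV 32)))))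
  (Seq (asg 26 (fetch (EV 33)))
  (Seq (asg 27 (fetch (plus (EV 33) 1)))
  (Seq (asg 34 (fetch (plus (EV 33) 2)))
  (asg 35 (EB Mul (EB Eqn (EV 34) (EV 25))
     (EB Eqn (EB Shr (ES (EV 26)) (EB Defs.Sub vW (EV 25)))
             (prefix_expr (EV 25)))))))))))))).

(** Probing the minimum of the square and the midpoint lets one loop serve both phases; the
    assignment of register 25 to itself only completes the conditional. *)
Definition search_body : program :=
  Seq (asg 25 (EB Shr (EB Add (EV 23) (EV 24)) (EC 1)))
  (Seq (cif (EB Ltn (EB Mul (EV 23) (EV 23)) (EV 25))
          (asg 25 (EB Mul (EV 23) (EV 23))) (asg 25 (EV 25)))
  (Seq probe
    (cif (EV 35) (Seq apply_range (asg 23 (EV 25))) (asg 24 (EV 25))))).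

Definition search_cond : expr :=
  EB Mul (EB Ltn vA vB) (EB Ltn (plus (EV 23) 1) (EV 24)).

Definition search : program := cwhile search_cond search_body.

Definition decode : program :=
  Seq (cif (EB Eqn (EI (EC 0)) (EC 3))
        (Seq (asg 10 (EC 1)) (Seq (asg 11 (EC 0)) (asg 12 vW)))
        (Seq (asg 10 (EC 0)) (Seq (asg 11 (plus vN 2)) (asg 12 (plus vN 2)))))
  (Seq (asg 13 (hfield 1)) (Seq (asg 14 (hfield 2)) (Seq (asg 15 (hfield 3))
  (Seq (asg 16 (hfield 4)) (Seq (asg 17 (hfield 5)) (Seq (asg 18 (hfield 6))
  (Seq (asg 19 (hfield 7)) (Seq (asg 20 (hfield 8))
  (Seq (asg 21 (EB Mul (EV 10) (EC 9))) (Seq (asg 22 (EB Mul (EV 11) (EC 9)))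
  (asg 9 (EB Shr (EV 14) (EC 1))))))))))))).

Definition descend : program :=
  Seq (asg 33 (EB Mul (EC 3) (prefix_expr (EV 9))))
  (Seq (asg 26 (fetch (EV 33)))
  (Seq (asg 27 (fetch (plus (EV 33) 1)))
  (Seq apply_range
  (Seq (asg 23 (EV 9)) (asg 24 (plus (EV 15) 1)))))).

(** * Reading fields of the index *)

Section Eval.
Variables (w : nat) (S : {set word w}) (B : seq bool).
Local Notation P := (2 ^ w).
Local Notation ev := (evn S B).
Variable r : env.
Hypothesis rw : r 1 = w.

Lemma ev_low e k v j : ev e r = v -> ev k r = j -> j <= w ->
  ev (low e k) r = v %% 2 ^ j.
Proof.
move=> ee ek jw.
have esub : ev (EB Defs.Sub vW k) r = w - j.
  by rewrite (@ev_sub _ _ _ _ _ _ w j) // ltn_expl.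
rewrite (@ev_shr _ _ _ _ _ _ (v * 2 ^ (w - j) %% P) (w - j)) //.
- rewrite -[in 2 ^ w](subnK jw) addnC expnD -muln_modl mulnK // expn_gt0 //.
- exact: ev_shl.
- by rewrite ltn_pmod // expn_gt0.
Qed.

Lemma ev_hsh ea ek eu er a k u q : ev ea r = a -> ev ek r = k ->
  ev eu r = u -> ev er r = q -> q <= u <= w ->
  ev (hsh ea ek eu er) r = mhash u q a k.
Proof.
move=> ha hk hu hq /andP[qu uw].
have qw := leq_trans qu uw.
have esub e v : ev e r = v -> v <= w -> ev (EB Defs.Sub vW e) r = w - v.
  by move=> ee vw; rewrite (@ev_sub _ _ _ _ _ _ w v) // ltn_expl.
have emul : ev (EB Mul ea ek) r = a * k %% P by rewrite /= ha hk.
rewrite (@ev_shr _ _ _ _ _ _ ((a * k %% P) * 2 ^ (w - u) %% P) (w - q)) //.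
- rewrite modnMml -[in X in _ %% X](subnK uw) [w - u + u]addnC expnD -muln_modl.
  rewrite /mhash; have -> : w - q = (u - q) + (w - u) by lia.
  by rewrite expnD divnMr // expn_gt0.
- by rewrite (ev_shl emul (esub _ _ hu uw)).
- exact: esub.
- by rewrite ltn_pmod // expn_gt0.
Qed.

Lemma ev_prefix e q x : ev e r = q -> q <= w -> r 0 = x -> x < P ->
  ev (prefix_expr e) r = prefix_of w q x.
Proof.
move=> ee qw rx xP; apply: ev_shr => //.
by rewrite (@ev_sub _ _ _ _ _ _ w q) // ltn_expl.
Qed.

Lemma ev_plus e v k : ev e r = v -> v + k < P -> ev (plus e k) r = v + k.
Proof.
move=> ee vk; apply: ev_add => //; apply: ev_const.
by apply: leq_ltn_trans vk; apply: leq_addl.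
Qed.

Section Layout.
Variables (om t f tau rho ob hw : nat) (H F : nat -> nat).
Hypothesis lay : index_layout w om 9 t f tau H F
  (fun a => read_index w B a %% 2 ^ w) rho ob hw.

Lemma ev_hfield i : 10 <= w -> 0 < i < 9 -> r 10 = rho -> r 11 = ob -> r 12 = hw ->
  ev (hfield i) r = header tau 0 H i.
Proof.
move=> w10 /andP[i0 i9] e10 e11 e12; case: lay => [[_ _ hww rho1] _ obw hd _].
have iP : i < P by apply: leq_trans (ltnW (ltn_expl _ (isT : 1 < 2))); lia.
have obi : ob * i < P.
  apply: leq_ltn_trans (ltn_expl w (isT : 1 < 2)); apply: leq_trans obw.
  by rewrite leq_mul2l (ltnW i9) orbT.
have e1 : ev (EB Mul (EV 10) (EC i)) r = rho * i.
  by apply: ev_mul => //; [apply: ev_const|case: (rho) rho1 => [|[|]] // _; rewrite ?mul0n ?mul1n ?expn_gt0].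
have e2 : ev (EB Mul (EV 11) (EC i)) r = ob * i.
  by apply: ev_mul => //; apply: ev_const.
rewrite (@ev_low _ _ (read_index w B (rho * i) %% P %/ 2 ^ (ob * i)) hw) //.
  by rewrite hd // i0.
rewrite (ev_shr (ev_index e1) e2) // ltn_pmod // expn_gt0 //.
Qed.

Lemma ev_fetch e i : f <= w -> t <= P -> i < t -> ev e r = i ->
  r 13 = tau -> r 20 = f -> r 21 = rho * 9 -> r 22 = ob * 9 ->
  ev (fetch e) r = F i.
Proof.
move=> fw tP it ee e13 e20 e21 e22.
case: lay => [[_ tauw _ _] _ obw _ /(_ _ it)[b1 b2 <-]].
have b3 : ob * 9 + i %% 2 ^ tau * f < P.
  by apply: leq_ltn_trans b2 (ltn_expl w (isT : 1 < 2)).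
apply: ev_low => //.
have ea : ev (EB Add (EV 21) (EB Shr e (EV 13))) r = rho * 9 + i %/ 2 ^ tau.
  by apply: ev_add => //; apply: ev_shr => //; apply: leq_trans tP.
apply: (ev_shr (ev_index ea)); last by rewrite ltn_pmod // expn_gt0.
apply: ev_add => //; apply: ev_mul => //; first exact: ev_low.
by apply: leq_ltn_trans b3; apply: leq_addl.
Qed.

End Layout.
End Eval.

(** * Search for the longest heavy prefix *)

Section Descent.
Variables (w : nat) (S : {set word w}) (h : hash_family w) (B : seq bool).
Variable x : word w.
Local Notation n := #|S|.
Local Notation A := (nth 0 (array S)).
Local Notation rk := (rank_in (array S)).
Local Notation P := (2 ^ w).
Local Notation ev := (evn S B).
Local Notation hp := (hp S h B).

Lemma apply_range_ok (r : env) : 0 < w -> r 0 = x -> r 1 = w -> r 26 <= rk x <= r 27 -> r 27 < n ->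
  hp apply_range r (fun r' => [/\ bracket S x r',
    forall v, v != 3 -> v != 4 -> r' v = r v &
    r' 3 = r' 4 \/ [/\ r' 3 = r 26, r' 4 = r 27, r 26 < rk x & rk x < r 27]]).
Proof.
move=> w0 rx rw /andP[lo hi] rn.
have nP : n <= P := card_le_words S.
have frame a b : forall v, v != 3 -> v != 4 -> upd (upd r 3 a) 4 b v = r v.
  by move=> [|[|[|[|[|v]]]]].
have eA : ev (EB Ltn (ES (EV 26)) vX) r = (A (r 26) < x).
  by rewrite (@ev_ltn _ _ _ _ _ _ (A (r 26)) x).
apply: hp_if => //; rewrite eA array_lt_rank; try lia; case: ltnP => // cmp _.
  have e1 : ev (EB Defs.Sub (EV 27) (EC 1)) r = r 27 - 1.
    apply: ev_sub => //; last lia; last lia.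
    by apply: ev_const; rewrite -[X in X < _](expn0 2) ltn_exp2l.
  apply: hp_if => //; rewrite (@ev_ltn _ _ _ _ _ _ (A (r 27 - 1)) x) //;
    try exact: ev_array e1; rewrite array_lt_rank; try lia; case: ltnP => // cmp2 _;
    apply: hp_seq; apply: hp_asg => //; apply: hp_asg => //; split; try exact: frame.
  - by split; rewrite /upd //=; lia.
  - by left.
  - by split; rewrite /upd //=; lia.
  - by right; split; rewrite /upd //=; lia.
apply: hp_seq; apply: hp_asg => //; apply: hp_asg => //; split; try exact: frame.
- by split; rewrite /upd //=; apply: leq_ltn_trans rn; apply: leq_trans lo hi.
- by left.
Qed.

Local Notation nu := (size_log S).
Local Notation m0 := (nu./2).
Local Notation L := (max_length S).
Local Notation f := (field_size S).
Hypothesis nu_big : 128 <= nu.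

Variables (r0 s a0 a1 t : nat) (F : nat -> nat).
Hypothesis tab : table_spec S r0 s a0 a1 t F.
Hypothesis t_small : t <= n.

Definition header_fields (i : nat) : nat :=
  match i with
  | 2 => nu | 3 => L | 4 => r0 | 5 => s | 6 => a0 | 7 => a1 | 8 => f | _ => 0
  end.

Variables (tau rho ob hw : nat).
Hypothesis lay : index_layout w n.+1 9 t f tau header_fields F
  (fun a => read_index w B a %% 2 ^ w) rho ob hw.

Definition is_static (v : nat) : bool := (v <= 2) || (9 <= v <= 22).
Definition static_value (v : nat) : nat :=
  match v with
  | 0 => x | 1 => w | 2 => n.-1 | 9 => m0 | 10 => rho | 11 => ob | 12 => hw
  | 13 => tau | 14 => nu | 15 => L | 16 => r0 | 17 => s | 18 => a0 | 19 => a1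
  | 20 => f | 21 => rho * 9 | 22 => ob * 9 | _ => 0
  end.
Definition static (r : env) : Prop :=
  forall v, is_static v -> r v = static_value v.

Lemma static_upd r v k : ~~ is_static v -> static r -> static (upd r v k).
Proof.
move=> nv st u uv; rewrite /upd; case e: (Nat.eqb u v); last exact: st.
by move/PeanoNat.Nat.eqb_eq: e uv nv => ->; move=> ->.
Qed.

Lemma w_big : 127 <= w.
Proof. by have := nu_le_w nu_big; lia. Qed.

Lemma L_lt_w : L < w.
Proof. by have := w_big; have := geq_minr n w.-1; rewrite -/L; lia. Qed.

Lemma two_m0 : 2 ^ m0 < P.
Proof. by rewrite ltn_exp2l //; have := w_big; have := nu_le_w nu_big; lia. Qed.

Lemma fetch_static (r : env) e i : static r -> ev e r = i -> i < t ->
  ev (fetch e) r = F i.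
Proof.
move=> st ee it.
have tP : t <= P := leq_trans t_small (card_le_words S).
apply: (ev_fetch (st 1 isT) lay (geq_minl _ _) tP it ee).
- exact: (st 13 isT).
- exact: (st 20 isT).
- exact: (st 21 isT).
- exact: (st 22 isT).
Qed.

Lemma fetch_plus_static (r : env) v i j : static r -> r v = i -> i + j < t ->
  ev (fetch (plus (EV v) j)) r = F (i + j).
Proof.
move=> st ee it; apply: fetch_static => //; apply: ev_plus => //.
exact: leq_trans it (leq_trans t_small (card_le_words S)).
Qed.

Lemma probe_ok (r : env) q : static r -> r 25 = q -> 0 < q <= L ->
  hp probe r (fun r' => [/\ static r',
    forall v, v \in [:: 3; 4; 23; 24; 25] -> r' v = r v,
    r' 35 != 0 -> [/\ first_rank S q (prefix_of w q x) < n,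
      r' 26 = first_rank S q (prefix_of w q x) &
      r' 27 = clamped_rank S q (prefix_of w q x).+1] &
    r' 35 = 0 -> ~~ heavy S q (prefix_of w q x)]).
Proof.
move=> st rq /andP[q0 qL].
have qw : q < w := leq_ltn_trans qL L_lt_w.
have w127 := w_big.
have w0 : 0 < w by lia.
have nP : n <= P := card_le_words S.
have tP : t <= P := leq_trans t_small nP.
have Lw : L.+1 <= w := L_lt_w.
have small k : k <= w -> k < P.
  by move=> kw; apply: leq_ltn_trans kw (ltn_expl _ _).
have xP : x < P := ltn_ord x.
case: tab => [[a0u a1r sr rL] _ tab2 tab3].
have r0w := leq_trans rL Lw.
set k := code q (prefix_of w q x).
have pq : prefix_of w q x < 2 ^ q by apply: prefix_lt => //; apply: ltnW.
have kL : k < 2 ^ L.+1 by apply: code_lt.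
have kP : k < P by apply: leq_trans kL _; rewrite leq_exp2l.
have [b1 b2 b3] := tab2 _ kL.
have [sound complete] := tab3 _ _ (introT andP (conj q0 qL)) xP.
rewrite -/k in sound complete.
set k1 := mhash L.+1 r0 a0 k.
set b := bucket_field S r0 s a0 a1 k in b1 b2.
apply: hp_seq; apply: (@hp_set _ _ _ _ _ _ _ k) => //.
  apply: ev_add; last exact: kP.
    rewrite (@ev_shl _ _ _ _ _ _ 1 q) ?mul1n ?modn_small ?ltn_exp2l //.
    by apply: ev_const; apply: small.
  by apply: ev_prefix => //; [exact: st 1 isT|exact: ltnW|exact: st 0 isT].
set r1 := upd r _ _; have st1 : static r1 by apply: static_upd.
apply: hp_seq; apply: (@hp_set _ _ _ _ _ _ _ k1) => //.
  apply: ev_hsh => //.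
  - exact: st1 1 isT.
  - exact: st1 18 isT.
  - rewrite -(addn1 L); apply: ev_plus; first exact: st1 15 isT.
    by rewrite addn1; apply: small.
  - exact: st1 16 isT.
  - by rewrite rL.
set r2 := upd r1 _ _; have st2 : static r2 by apply: static_upd.
apply: hp_seq; apply: (@hp_set _ _ _ _ _ _ _ b) => //.
  have bP : b < P by apply: leq_trans tP; lia.
  rewrite /b /bucket_field in bP *.
  apply: ev_mul => //; first by apply: ev_const; apply: small; lia.
  apply: ev_add; last by move: bP; lia.
    rewrite (@ev_shl _ _ _ _ _ _ 1 m0) ?mul1n ?modn_small ?two_m0 //.
      by apply: ev_const; apply: small.
    exact: st2 9 isT.
  apply: ev_hsh => //.
  - exact: st2 1 isT.
  - exact: st2 19 isT.
  - exact: st2 16 isT.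
  - exact: st2 17 isT.
  - by rewrite sr.
set r3 := upd r2 _ _; have st3 : static r3 by apply: static_upd.
apply: hp_seq; apply: (@hp_set _ _ _ _ _ _ _ (F b)) => //.
  by apply: fetch_static => //; lia.
set r4 := upd r3 _ _; have st4 : static r4 by apply: static_upd.
apply: hp_seq; apply: (@hp_set _ _ _ _ _ _ _ (F b.+1)) => //.
  by rewrite -(addn1 b); apply: fetch_plus_static => //; lia.
set r5 := upd r4 _ _; have st5 : static r5 by apply: static_upd.
apply: hp_seq; apply: (@hp_set _ _ _ _ _ _ _ (F b.+2)) => //.
  by rewrite -(addn2 b); apply: fetch_plus_static => //; lia.
set r6 := upd r5 _ _; have st6 : static r6 by apply: static_upd.
set e := slot_field S r0 s a0 a1 F k in b3 sound complete.
apply: hp_seq; apply: (@hp_set _ _ _ _ _ _ _ e) => //.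
  have eP : e < P by apply: leq_trans tP; lia.
  rewrite /e /slot_field -/b -/k1 in eP *.
  apply: ev_mul => //; first by apply: ev_const; apply: small; lia.
  apply: ev_add => //; last by move: eP; lia.
  apply: ev_hsh => //.
  - exact: st6 1 isT.
  - exact: st6 16 isT.
  - by rewrite b2.
set r7 := upd r6 _ _; have st7 : static r7 by apply: static_upd.
apply: hp_seq; apply: (@hp_set _ _ _ _ _ _ _ (F e)) => //.
  by apply: fetch_static => //; lia.
set r8 := upd r7 _ _; have st8 : static r8 by apply: static_upd.
apply: hp_seq; apply: (@hp_set _ _ _ _ _ _ _ (F e.+1)) => //.
  by rewrite -(addn1 e); apply: fetch_plus_static => //; lia.
set r9 := upd r8 _ _; have st9 : static r9 by apply: static_upd.
apply: hp_seq; apply: (@hp_set _ _ _ _ _ _ _ (F e.+2)) => //.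
  by rewrite -(addn2 e); apply: fetch_plus_static => //; lia.
set r10 := upd r9 _ _; have st10 : static r10 by apply: static_upd.
pose good := (F e.+2 == q) && (prefix_of w q (A (F e)) == prefix_of w q x).
apply: (@hp_set _ _ _ _ _ _ _ good) => //.
  have eW : ev (EB Defs.Sub vW (EV 25)) r10 = w - q.
    apply: ev_sub => //; [exact: st10 1 isT|exact: ltnW|exact: small].
  rewrite (@ev_mul _ _ _ _ _ _ (F e.+2 == q)
     (prefix_of w q (A (F e)) == prefix_of w q x)).
  - by rewrite mulnb.
  - exact: ev_eqn.
  - apply: ev_eqn => //; first by apply: ev_shr => //; apply: array_lt.
    by apply: ev_prefix => //; [exact: st10 1 isT|exact: ltnW|exact: st10 0 isT].
  - by rewrite mulnb; apply: leq_ltn_trans (leq_b1 _) (small 1 w0).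
split.
- exact: static_upd.
- by move=> v; rewrite !inE => /or4P[|||/orP[]] /eqP ->.
- rewrite /good /upd /=; case: andP => // -[/eqP g1 /eqP g2] _.
  exact: sound.
- rewrite /good /upd /=; case: andP => // ng _; apply/negP => /complete[g1 g2].
  by apply: ng; rewrite g1 g2 !eqxx.
Qed.

Lemma decode_ok (r : env) : r 0 = x -> r 1 = w -> r 2 = n.-1 ->
  hp decode r (fun r' => static r').
Proof.
move=> rx rw rn.
have w127 := w_big.
have w0 : 0 < w by lia.
have w10 : 10 <= w by lia.
have small k : k <= w -> k < P.
  by move=> kw; apply: leq_ltn_trans kw (ltn_expl _ _).
have n0 := n_gt0 nu_big.
case: (lay) => [[_ _ hww rho1] cases obw _ _].
have rest (r1 : env) : r1 0 = x -> r1 1 = w -> r1 2 = n.-1 -> r1 10 = rho ->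
    r1 11 = ob -> r1 12 = hw ->
    hp (Seq (asg 13 (hfield 1)) (Seq (asg 14 (hfield 2)) (Seq (asg 15 (hfield 3))
  (Seq (asg 16 (hfield 4)) (Seq (asg 17 (hfield 5)) (Seq (asg 18 (hfield 6))
  (Seq (asg 19 (hfield 7)) (Seq (asg 20 (hfield 8))
  (Seq (asg 21 (EB Mul (EV 10) (EC 9))) (Seq (asg 22 (EB Mul (EV 11) (EC 9)))
  (asg 9 (EB Shr (EV 14) (EC 1))))))))))))) r1 (fun r' => static r').
  move=> ex ew en e10 e11 e12.
  do 8 (apply: hp_seq; eapply hp_set;
    [by []|by []|by apply: (ev_hfield S _ lay w10)|cbn [header header_fields]]).
  have c9 r' : ev (EC 9) r' = 9 by apply: ev_const; apply: small; lia.
  apply: hp_seq; apply: (@hp_set _ _ _ _ _ _ _ (rho * 9)) => //.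
    apply: ev_mul; [exact: e10|exact: c9|].
    by apply: small; case: (rho) rho1 => [|[|]] // _; lia.
  apply: hp_seq; apply: (@hp_set _ _ _ _ _ _ _ (ob * 9)) => //.
    by apply: ev_mul; [exact: e11|exact: c9|exact: small].
  apply: (@hp_set _ _ _ _ _ _ _ m0) => //.
    rewrite (@ev_shr _ _ _ _ _ _ nu 1) ?expn1 ?divn2 //.
      by apply: ev_const; apply: small.
    have nu5 : 5 <= nu by lia.
    by have := double_lt_exp nu5; have := exp_nu_le nu_big; have := card_le_words S; lia.
  by do 23 (case=> [|] //).
have e0 r' : ev (EC 0) r' = 0 by apply: ev_const; apply: small.
have e3 r' : ev (EC 3) r' = 3 by apply: ev_const; apply: small; lia.
apply: hp_seq; apply: hp_if => //.
- rewrite (@ev_eqn _ _ _ _ _ _ (read_index w B 0 %% P) 3) //;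
    try exact: e3; try by apply: ev_index.
  move=> c; have c3 : read_index w B 0 %% P == 3.
    by move: c; case: (read_index w B 0 %% P == 3).
  move: cases; rewrite c3 /= orbF => /and3P[/eqP rE /eqP oE /eqP hE].
  apply: hp_seq; apply: (@hp_set _ _ _ _ _ _ _ 1) => //.
    by apply: ev_const; apply: small.
  apply: hp_seq; apply: (@hp_set _ _ _ _ _ _ _ 0) => //.
  by apply: (@hp_set _ _ _ _ _ _ _ w) => //; apply: rest; rewrite /= ?rE ?oE ?hE.
- rewrite (@ev_eqn _ _ _ _ _ _ (read_index w B 0 %% P) 3) //;
    try exact: e3; try by apply: ev_index.
  move=> c; have c3 : (read_index w B 0 %% P == 3) = false.
    by move: c; case: (read_index w B 0 %% P == 3).
  move: cases; rewrite c3 /= => /and3P[/eqP rE /eqP oE /eqP hE].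
  apply: hp_seq; apply: (@hp_set _ _ _ _ _ _ _ 0) => //.
  have nw : n.+1 <= w by rewrite -oE; apply: leq_trans obw; rewrite leq_pmulr.
  have n2 (r' : env) : r' 2 = n.-1 -> ev (plus vN 2) r' = n.+1.
    move=> e; have -> : n.+1 = n.-1 + 2 by lia.
    by apply: ev_plus => //; apply: small; lia.
  apply: hp_seq; apply: (hp_set _ _ (n2 _ _)) => //.
  by apply: (hp_set _ _ (n2 _ _)) => //; apply: rest; rewrite /= ?rE ?oE ?hE.
Qed.

Definition straddles (l a b : nat) : Prop :=
  [/\ a = first_rank S l (prefix_of w l x),
    b = clamped_rank S l (prefix_of w l x).+1, a < rk x & rk x < b].

(** The elements at positions [a] and [b - 1] have the prefix of length [l] and enclose [x], so both
    neighbours of [x] have it too. This is how [D(x, S)] enters the time bound. *)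
Lemma straddles_distance l a b : straddles l a b -> l <= w ->
  0 < distance S x < 2 ^ (w - l).
Proof.
move=> [-> -> lo hi] lw.
set p := prefix_of w l x in lo hi *.
have bn : clamped_rank S l p.+1 <= n.-1 by apply: geq_minr.
have bf : clamped_rank S l p.+1 <= first_rank S l p.+1 by apply: geq_minl.
have jn : (clamped_rank S l p.+1).-1 < n.
  by apply: leq_ltn_trans (leq_pred _) (leq_ltn_trans bn _); rewrite prednK // n_gt0.
have iN : first_rank S l p < n.
  apply: ltn_trans lo _; apply: leq_trans hi _; apply: leq_trans bn (leq_pred _).
have -> : 2 ^ (w - l) = p.+1 * 2 ^ (w - l) - p * 2 ^ (w - l).
  by rewrite -mulnBl subSnn mul1n.
apply: (distance_bound iN jn).
- rewrite array_lt_rank // lo /= leqNgt array_lt_rank // -leqNgt.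
  by case: (clamped_rank _ _ _) hi.
- by rewrite leqNgt array_lt_rank // -leqNgt.
- rewrite array_lt_rank //; apply: leq_trans bf.
  by case: (clamped_rank _ _ _) hi.
Qed.

Lemma descend_ok (r : env) : static r -> rk x < n ->
  hp descend r (fun r' => [/\ static r', bracket S x r', r' 23 = m0,
    r' 24 = L.+1 & r' 3 = r' 4 \/ straddles m0 (r' 3) (r' 4)]).
Proof.
move=> st rn.
have w127 := w_big.
have w0 : 0 < w by lia.
have nP : n <= P := card_le_words S.
have small k : k <= w -> k < P.
  by move=> kw; apply: leq_ltn_trans kw (ltn_expl _ _).
have xP : x < P := ltn_ord x.
have m0w : m0 <= w by have := nu_le_w nu_big; lia.
case: tab => [_ tab1 _ _].
set p := prefix_of w m0 x.
have pm : p < 2 ^ m0 by apply: prefix_lt.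
have [b1 b2 b3] := tab1 _ pm.
have tP : t <= P := leq_trans t_small nP.
apply: hp_seq; apply: (@hp_set _ _ _ _ _ _ _ (3 * p)) => //.
  apply: ev_mul.
  - by apply: ev_const; apply: small; lia.
  - by apply: ev_prefix => //; [exact: st 1 isT|exact: st 9 isT|exact: st 0 isT].
  - by apply: leq_trans tP; apply: ltnW.
set r1 := upd r _ _; have st1 : static r1 by apply: static_upd.
apply: hp_seq; apply: (@hp_set _ _ _ _ _ _ _ (F (3 * p))) => //.
  by apply: fetch_static => //; apply: ltnW.
set r2 := upd r1 _ _; have st2 : static r2 by apply: static_upd.
apply: hp_seq; apply: (@hp_set _ _ _ _ _ _ _ (F (3 * p).+1)) => //.
  by rewrite -(addn1 (3 * p)); apply: fetch_plus_static; rewrite ?addn1.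
set r3 := upd r2 _ _; have st3 : static r3 by apply: static_upd.
have /andP[lo hi] := rank_prefix S m0 x.
have r26 : r3 26 = clamped_rank S m0 p by rewrite -b2.
have r27 : r3 27 = clamped_rank S m0 p.+1 by rewrite -b3.
have n0 := n_gt0 nu_big.
apply: hp_seq; apply: hp_conseq.
  apply: apply_range_ok => //; [exact: st3 0 isT|exact: st3 1 isT| |].
  - rewrite r26 r27 leq_min hi (leq_trans (geq_minl _ _) lo) /=.
    by rewrite -ltnS prednK.
  - by rewrite r27; apply: leq_ltn_trans (geq_minr _ _) _; rewrite prednK.
move=> r4 [br fr cmp].
have st4 : static r4.
  by move=> v sv; rewrite fr ?st3 //; apply: contraTneq sv => ->.
apply: hp_seq; apply: (@hp_set _ _ _ _ _ _ _ m0) => //; first exact: st4 9 isT.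
apply: (@hp_set _ _ _ _ _ _ _ L.+1) => //.
  rewrite -(addn1 L); apply: ev_plus; first exact: st4 15 isT.
  by rewrite addn1; apply: small; apply: L_lt_w.
split=> //.
- by apply: static_upd => //; apply: static_upd.
- rewrite /upd /=; case: cmp => [->|[e3 e4 lt1 lt2]]; first by left.
  right; rewrite /straddles e3 e4 r26 r27 in lt1 lt2 *.
  (* If clamping changed the left end, [n - 1 < rk x < n] would follow. *)
  have e : clamped_rank S m0 p = first_rank S m0 p.
    apply/minn_idPl; rewrite leqNgt; apply/negP => ge.
    move: lt1; rewrite /clamped_rank (minn_idPr (ltnW ge)).
    by move: rn; case: #|S| n0 => // k _; lia.
  by split=> //; rewrite -e.
Qed.

(** [L + 1] is a sentinel that is never probed. Nothing is claimed about the weight at the lower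
    end, since the first range comes from the direct table. *)
Definition descent_state (r : env) : Prop :=
  [/\ static r, bracket S x r & r 3 = r 4 \/
    [/\ straddles (r 23) (r 3) (r 4), m0 <= r 23 <= L, r 23 < r 24 <= L.+1 &
      r 24 = L.+1 \/ ~~ heavy S (r 24) (prefix_of w (r 24) x)]].

Lemma square_le_exp k : 4 <= k -> k * k <= 2 ^ k.
Proof.
elim: k => // k IH; rewrite leq_eqVlt => /predU1P[<-//|k4].
have := IH k4; rewrite expnS; nia.
Qed.

Lemma search_body_ok (r : env) : descent_state r -> r 3 < r 4 ->
  r 23 + 1 < r 24 ->
  hp search_body r (fun r' => descent_state r' /\ (r' 3 = r' 4 \/
    let q := minn (r 23 * r 23) ((r 23 + r 24) %/ 2) in
    (r' 23 = q /\ r' 24 = r 24) \/ (r' 23 = r 23 /\ r' 24 = q))).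
Proof.
move=> [st br [e|[str /andP[lo1 lo2] /andP[hi1 hi2] hv]]] ab gap; first lia.
set q := minn (r 23 * r 23) ((r 23 + r 24) %/ 2).
have w127 := w_big.
have w0 : 0 < w by lia.
have m64 : 64 <= m0 by have := half_leq nu_big.
have Lw := L_lt_w.
have small k : k <= w -> k < P.
  by move=> kw; apply: leq_ltn_trans kw (ltn_expl _ _).
have sqP : r 23 * r 23 < P.
  apply: leq_trans (@square_le_exp w _); last lia.
  by apply: ltn_mul; lia.
have sumP : r 23 + r 24 < P.
  apply: leq_trans (@square_le_exp w _); last lia.
  by apply: (@leq_trans (2 * w)); [lia|rewrite leq_mul2r; lia].
have midq : r 23 < (r 23 + r 24) %/ 2 < r 24 by lia.
have sqlt : r 23 < r 23 * r 23 by nia.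
have qlo : r 23 < q by rewrite leq_min sqlt; case/andP: midq.
have qhi : q < r 24.
  by apply: leq_ltn_trans (geq_minr _ _) _; case/andP: midq.
set mid := (r 23 + r 24) %/ 2 in midq q qlo qhi *.
apply: hp_seq; apply: (@hp_set _ _ _ _ _ _ _ mid) => //.
  have e1 : ev (EB Add (EV 23) (EV 24)) r = r 23 + r 24 by apply: ev_add.
  have ec1 : ev (EC 1) r = 1 by apply: ev_const; apply: small.
  by rewrite (ev_shr e1 ec1) // expn1.
set r1 := upd r _ _; have st1 : static r1 by apply: static_upd.
have esq : ev (EB Mul (EV 23) (EV 23)) r1 = r 23 * r 23 by apply: ev_mul.
have rest : hp (Seq probe (cif (EV 35) (Seq apply_range (asg 23 (EV 25)))
    (asg 24 (EV 25)))) (upd r1 25 q) (fun r' => descent_state r' /\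
    (r' 3 = r' 4 \/ (r' 23 = q /\ r' 24 = r 24) \/ (r' 23 = r 23 /\ r' 24 = q))).
  set r2 := upd r1 25 q; have st2 : static r2 by apply: static_upd.
  have qL : 0 < q <= L by lia.
  have qm : m0 <= q <= L by rewrite (leq_trans lo1 (ltnW qlo)); case/andP: qL.
  apply: hp_seq; apply: hp_conseq; first exact: (probe_ok st2 (erefl q) qL).
  move=> r3 [st3 fr3 yes no].
  have f3 : r3 3 = r 3 by rewrite fr3.
  have f4 : r3 4 = r 4 by rewrite fr3.
  have f23 : r3 23 = r 23 by rewrite fr3.
  have f24 : r3 24 = r 24 by rewrite fr3.
  have f25 : r3 25 = q by rewrite fr3.
  have [_ _ br3 br4 br5] := br.
  apply: hp_if => // /= hf.
    have [fn A26 B27] := yes hf.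
    have /andP[lo hi] := rank_prefix S q x.
    apply: hp_seq; apply: hp_conseq.
      apply: apply_range_ok => //; [exact: st3 0 isT|exact: st3 1 isT| |].
      - rewrite A26 B27 leq_min lo hi /=.
        by rewrite -ltnS prednK ?(n_gt0 nu_big) // (leq_ltn_trans br4).
      - rewrite B27; apply: leq_ltn_trans (geq_minr _ _) _.
        by rewrite prednK // (n_gt0 nu_big).
    move=> r4 [brr fr4 cmp].
    apply: (@hp_set _ _ _ _ _ _ _ q) => //; first by rewrite /= fr4.
    have st4 : static r4.
      by move=> v sv; rewrite fr4 ?st3 //; apply: contraTneq sv => ->.
    have st5 : static (upd r4 23 q) by apply: static_upd.
    have r4_24 : r4 24 = r 24 by rewrite fr4.
    rewrite /descent_state /upd /= r4_24; split; last by right; left.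
    split=> //; case: cmp => [->|[e3 e4 lt1 lt2]]; first by left.
    right; split=> //; last by rewrite qhi.
    by rewrite /straddles e3 e4 -B27 -A26.
  apply: (@hp_set _ _ _ _ _ _ _ q) => //.
  have st5 : static (upd r3 24 q) by apply: static_upd.
  rewrite /descent_state /upd /= f3 f4 f23; split; last by right; right.
  split=> //; first by rewrite /bracket /= f3 f4; split=> //; [exact: st3 0 isT|exact: st3 1 isT].
  right; split=> //; [exact/andP|by rewrite qlo (leq_trans (ltnW qhi))|].
  by right; apply: no.
apply: hp_seq; apply: hp_if => //;
  rewrite (@ev_ltn _ _ _ _ _ _ (r 23 * r 23) mid) //; case: ltnP => // cmp _.
- apply: (hp_set _ _ esq) => //.
  by rewrite -[r 23 * r 23](minn_idPl (ltnW cmp)).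
- apply: (@hp_set _ _ _ _ _ _ _ mid) => //.
  by rewrite -[mid in upd r1 _ mid](minn_idPr cmp).
Qed.

Variable K : nat.
Hypothesis K_max : forall l, l <= w -> 0 < distance S x < 2 ^ (w - l) -> l <= K.
Local Notation KL := (trunc_log 2 K).

Lemma K_lt : K < 2 ^ KL.+1.
Proof. exact: trunc_log_ltn. Qed.

Lemma straddles_le_K l a b : straddles l a b -> l <= L -> l <= K.
Proof.
move=> str lL; have lw : l <= w := leq_trans lL (ltnW L_lt_w).
exact: K_max lw (straddles_distance str lw).
Qed.

Lemma search_cond_true (r : env) : descent_state r -> ev search_cond r != 0 ->
  r 3 < r 4 /\ r 23 + 1 < r 24.
Proof.
have w127 := w_big; have w0 : 0 < w by lia.
have one : 1 < P by rewrite -[X in X < _](expn0 2) ltn_exp2l.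
move=> [st br cases].
have eAB : ev (EB Ltn vA vB) r = (r 3 < r 4) by apply: ev_ltn.
case: (ltnP (r 3) (r 4)) eAB => [ab eAB|ba eAB]; last first.
  by rewrite /= in eAB *; rewrite eAB mul0n mod0n.
case: cases => [e|[_ /andP[_ lo] /andP[lt hi] _]]; first lia.
have Lw := L_lt_w.
have lP : r 23 + 1 < P by apply: leq_ltn_trans (ltn_expl w (isT : 1 < 2)); lia.
have e1 : ev (plus (EV 23) 1) r = r 23 + 1 by apply: ev_plus.
have e2 : ev (EB Ltn (plus (EV 23) 1) (EV 24)) r = (r 23 + 1 < r 24).
  exact: ev_ltn.
rewrite (@ev_mul _ _ _ _ _ _ _ _ eAB e2) ?mul1n; last by case: (_ < r 24) => //; lia.
by case: ltnP.
Qed.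

Lemma search_cond_false (r : env) : descent_state r -> ev search_cond r = 0 ->
  r 3 = r 4 \/ r 24 <= r 23 + 1.
Proof.
have w127 := w_big; have w0 : 0 < w by lia.
have one : 1 < P by rewrite -[X in X < _](expn0 2) ltn_exp2l.
move=> [st br cases].
case: cases => [e _|[[_ _ h1 h2] /andP[_ lo] /andP[lt hi] _]]; first by left.
have eAB : ev (EB Ltn vA vB) r = 1.
  by rewrite (@ev_ltn _ _ _ _ _ _ (r 3) (r 4)) // (ltn_trans h1 h2).
have Lw := L_lt_w.
have lP : r 23 + 1 < P by apply: leq_ltn_trans (ltn_expl w (isT : 1 < 2)); lia.
have e1 : ev (plus (EV 23) 1) r = r 23 + 1 by apply: ev_plus.
have e2 : ev (EB Ltn (plus (EV 23) 1) (EV 24)) r = (r 23 + 1 < r 24).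
  exact: ev_ltn.
rewrite (@ev_mul _ _ _ _ _ _ _ _ eAB e2) ?mul1n; last by case: (_ < r 24) => //; lia.
by case: ltnP => // ? _; right.
Qed.

(* While the search is wide, a success at the square of [lo] increases
   [trunc_log 2 lo], and any other outcome makes it narrow with [k = 2 KL + 2];
   once narrow, it is an ordinary binary search. *)
Definition narrow (k lo hi : nat) : Prop := hi <= lo * lo /\ hi - lo <= 2 ^ k.
Definition wide (k lo : nat) : Prop := 3 * KL + 4 <= k + trunc_log 2 lo.

Lemma le_K_square l : l <= K -> l * l <= 2 ^ (2 * KL + 2).
Proof.
move=> lK; have := leq_ltn_trans lK K_lt => lt.
have -> : 2 * KL + 2 = KL.+1 + KL.+1 by lia.
by rewrite expnD; apply: leq_mul; apply: ltnW.
Qed.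

Lemma search_progress k lo hi lo' hi' : 64 <= lo -> lo + 1 < hi -> lo <= K ->
  lo' <= K -> narrow k lo hi \/ wide k lo ->
  (let q := minn (lo * lo) ((lo + hi) %/ 2) in
    (lo' = q /\ hi' = hi) \/ (lo' = lo /\ hi' = q)) ->
  exists2 k', k' < k & narrow k' lo' hi' \/ wide k' lo'.
Proof.
move=> lo64 gap loK lo'K [[n1 n2]|W] /=.
  have k0 : 0 < k by case: k n2 => //; rewrite expn0; lia.
  have e2 : 2 ^ k = 2 * 2 ^ k.-1 by rewrite -expnS prednK.
  rewrite (minn_idPr _); last lia.
  move=> step; exists k.-1; first lia.
  left; case: step => -[-> ->]; split; try lia.
  by apply: leq_trans n1 _; apply: leq_mul; lia.
(* Hence [k >= 2 KL + 4] in the wide phase, which leaves room for the [2 KL + 2] of the narrow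
   phase. *)
have tlK : trunc_log 2 lo <= KL by apply: leq_trunc_log.
rewrite /wide in W *.
case: leqP => cmp step; last first.
  exists (2 * KL + 2); first lia.
  left; case: step => -[elo ehi]; subst lo' hi'.
    have himid : hi <= (lo + hi) %/ 2 * ((lo + hi) %/ 2).
      by apply: leq_trans (_ : 3 * ((lo + hi) %/ 2) <= _); [lia|rewrite leq_mul2r; lia].
    split=> //; apply: leq_trans (leq_subr _ _) _.
    exact: leq_trans himid (le_K_square lo'K).
  split; first exact: ltnW.
  by apply: leq_trans (le_K_square loK); lia.
case: step => -[-> ->].
  exists k.-1; first lia.
  (* Squaring at least doubles the logarithm; an increase by one is all that the bound needs. *)
  right; suff : (trunc_log 2 lo).+1 <= trunc_log 2 (lo * lo) by lia.
  apply: trunc_log_max => //; rewrite expnSr; apply: leq_mul; last lia.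
  by apply: trunc_logP => //; lia.
exists (2 * KL + 2); first lia.
by left; split=> //; apply: leq_trans (leq_subr _ _) (le_K_square loK).
Qed.

Lemma search_ok (z : env) : descent_state z -> z 23 = m0 ->
  ht S h B search z
    ((3 * KL + 5) * (max_time search_body + cost search_cond + 1))
    (fun r => descent_state r /\ (r 3 = r 4 \/ r 24 <= r 23 + 1)).
Proof.
move=> dz z23; have m64 : 64 <= m0 by have := half_leq nu_big.
pose I k (r : env) := descent_state r /\
  (r 3 = r 4 \/ narrow k (r 23) (r 24) \/ wide k (r 23)).
apply: (@ht_while _ S h B _ _ I _ _ _ _ _ (3 * KL + 4)) => //.
- by move=> k r [dr _] c; split=> //; apply: search_cond_false.
- move=> k r [dr pot] c; have [ab gap] := search_cond_true dr c.
  have [st br [e|[str /andP[lo1 lo2] hi hv]]] := dr; first lia.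
  have loK := straddles_le_K str lo2.
  have lo64 : 64 <= r 23 by apply: leq_trans lo1.
  have {}pot : narrow k (r 23) (r 24) \/ wide k (r 23) by case: pot => // e; lia.
  have k0 : 0 < k.
    case: pot => [[_]|]; first by case: (k) => //; rewrite expn0; lia.
    by rewrite /wide; have := leq_trunc_log 2 loK; lia.
  apply: ht_hp => //; apply: hp_conseq; first exact: search_body_ok.
  move=> r' [dr' [e|step]]; first by exists 0 => //; split=> //; left.
  have [_ _ [e|[str' /andP[_ lo2'] _ _]]] := dr'.
    by exists 0 => //; split=> //; left.
  have [k' k'k pot'] :=
    search_progress lo64 gap loK (straddles_le_K str' lo2') pot step.
  by exists k' => //; split=> //; right.
- by split=> //; right; right; rewrite /wide leq_addr.
- by rewrite leq_mul2r; apply/orP; right; rewrite -addnS.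
Qed.

Lemma prefix_of_half l : l < w -> prefix_of w l x = (prefix_of w l.+1 x) %/ 2.
Proof.
by move=> lw; rewrite /prefix_of -divnMA -expnSr; congr (_ %/ 2 ^ _); lia.
Qed.

(** The next longer prefix of [x] is the left or right half of the current one, so up to clamping
    its range shares an end with [[a, b]], and its weight bounds the distance of the rank from that
    end. At the sentinel, either [L = n] and the rank is at most [n = l], or [L = w - 1] and the
    range has at most two elements. *)
Lemma final_gap (r : env) : descent_state r -> r 3 = r 4 \/ r 24 <= r 23 + 1 ->
  minn (rk x - r 3) (r 4 - rk x) <= 2 ^ (3 * KL + 5).
Proof.
move=> [st br [e|[str /andP[lo1 lo2] /andP[hi1 hi2] hv]]] fin.
  by have [_ _ b1 b2 _] := br; rewrite geq_min; lia.
case: fin => [e|fin]; first by have [_ _ b1 b2] := str; lia.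
have hiE : r 24 = (r 23).+1 by lia.
have loK := straddles_le_K str lo2.
have [a_eq b_eq b1 b2] := str.
have := leq_ltn_trans loK K_lt; set l := r 23 in lo1 lo2 hi1 hiE loK a_eq b_eq * => lK.
have Lw := L_lt_w; have lw : l < w := leq_ltn_trans lo2 Lw.
have b_le : r 4 <= first_rank S l (prefix_of w l x).+1 by rewrite b_eq geq_minl.
set p := prefix_of w l x in a_eq b_le.
have KL1 : 2 ^ KL.+1 <= 2 ^ (3 * KL + 5) by rewrite leq_exp2l //; lia.
rewrite hiE in hv; case: hv => [[lL]|light].
  have [Ln|Lw1] : L = n \/ L = w.-1.
    by rewrite /L; case: (leqP n w.-1); [left|right].
  - rewrite geq_min; apply/orP; left; apply: leq_trans (leq_subr _ _) _.
    apply: leq_trans KL1; apply: leq_trans (ltnW lK); rewrite lL Ln.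
    by rewrite -size_array rank_size.
  - rewrite geq_min; apply/orP; right.
    have := weight_le S l p; have -> : w - l = 1 by lia.
    rewrite /weight -a_eq expn1 => le2.
    by apply: leq_trans (_ : 2 ^ 1 <= _); [lia|rewrite leq_exp2l //; lia].
set q := prefix_of w l.+1 x in light.
have pq : p = q %/ 2 by apply: prefix_of_half.
(* The three factors are [nu <= 2 l + 1], [l + 1] and [l + 2], each estimated by
   [l < 2 ^ (KL + 1)]. *)
have thr : threshold S l.+1 <= 2 ^ (3 * KL + 5).
  have -> : 3 * KL + 5 = KL.+2 + (KL.+1 + KL.+2) by lia.
  rewrite /threshold !expnD; apply: leq_mul.
    by rewrite expnS; have := odd_double_half nu; lia.
  by apply: leq_mul; rewrite ?[2 ^ KL.+2]expnS; lia.
apply: leq_trans thr; move: light; rewrite /heavy -ltnNge => light.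
apply: leq_trans (ltnW light); rewrite /weight.
have /andP[q1 q2] := rank_prefix S l.+1 x; rewrite -/q in q1 q2.
have twice c : first_rank S l.+1 (2 * c) = first_rank S l c.
  rewrite /first_rank; have -> : w - l = (w - l.+1).+1 by lia.
  by congr (rk _); rewrite expnS; ring.
have := odd_double_half q; have half : q./2 = p by rewrite pq divn2.
rewrite half geq_min -mul2n; case: (odd q) => /= qE.
  by apply/orP; right; rewrite -qE in q1 q2 *; rewrite -[(1 + _).+1]/(2 + 2 * p) -mulnS twice; lia.
by apply/orP; left; rewrite -qE add0n twice -a_eq in q1 q2 *; lia.
Qed.

End Descent.

(** * The complete query and its running time *)

Definition prepare : program :=
  Seq (asg 3 (EC 0)) (Seq (asg 4 vN)
    (cif (EI (EC 0)) (Seq decode descend) (asg 5 (EC 0)))).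

Definition finish : program :=
  Seq (asg 5 (EC 1)) (Seq gallop (Seq bisect (asg 0 (EB Defs.Sub vA (EC 1))))).

(** The first test settles rank [n], which need not be a word; afterwards all bounds are array
    positions. *)
Definition query : program :=
  cif (EB Ltn (ES vN) vX) (asg 0 vN)
    (Seq prepare (Seq search finish)).

Definition gallop_cost : nat :=
  max_time gallop_body + cost (EB Ltn vD half_gap) + 1.
Definition bisect_cost : nat := max_time bisect_body + cost (EB Ltn vA vB) + 1.
Definition search_step_cost : nat := max_time search_body + cost search_cond + 1.
Definition finish_cost : nat :=
  max_time (asg 5 (EC 1)) + gallop_cost + bisect_cost +
  max_time (asg 0 (EB Defs.Sub vA (EC 1))).
(** The factors cover both cases: with an index, [3 KL + 5] loop tests and galloping with exponent
    [3 KL + 5]; without one, galloping with exponent 127, which costs [127 + 4] units of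
    [finish_cost]. *)
Definition query_cost : nat :=
  cost (EB Ltn (ES vN) vX) + 1 + max_time (asg 0 vN) + max_time prepare +
  5 * search_step_cost + 132 * finish_cost.

Section Query.
Variables (w : nat) (S : {set word w}) (h : hash_family w) (B : seq bool).
Variable x : word w.
Hypotheses (w0 : 0 < w) (S0 : S != set0).
Local Notation n := #|S|.
Local Notation A := (nth 0 (array S)).
Local Notation rk := (rank_in (array S)).
Local Notation P := (2 ^ w).
Local Notation ev := (evn S B).
Local Notation hp := (hp S h B).
Local Notation ht := (ht S h B).
Local Notation K := (w - (trunc_log 2 (distance S x)).+1).
Local Notation KL := (trunc_log 2 K).

Lemma card_S_gt0 : 0 < n.
Proof. by rewrite card_gt0. Qed.

Lemma finish_ok m (z : env) : bracket S x z ->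
  minn (rk x - z 3) (z 4 - rk x) <= 2 ^ m ->
  ht finish z (finish_cost * m.+4) (fun r => r 0 = (rk x + (P - 1)) %% P).
Proof.
move=> bz le.
have e1 (r : env) : ev (EC 1) r = 1 by apply: ev_const; apply: one_lt.
have [zx zw za zb zn] := bz.
apply: (@ht_le _ _ _ _ _ _ (max_time (asg 5 (EC 1)) + (m.+3 * gallop_cost +
    (m.+4 * bisect_cost + max_time (asg 0 (EB Defs.Sub vA (EC 1))))))).
  rewrite /finish_cost; move: (max_time _) (max_time _) gallop_cost bisect_cost.
  by move=> a b c d; rewrite !mulnDl; nia.
apply: ht_seq (leqnn _) _; apply: ht_hp => //.
apply: (@hp_set _ _ _ _ _ _ _ 1) => //.
apply: ht_seq (leqnn _) _.
apply: ht_post (@gallop_ok _ S h B x w0 S0 (ltn_ord x) m (upd z 5 1) bz le (erefl _)) _.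
move=> r [br gap].
apply: ht_seq (leqnn _) _.
apply: ht_post (@bisect_ok _ S h B x w0 S0 (ltn_ord x) m.+3 r br gap) _.
move=> r' e.
apply: ht_hp => //; apply: hp_asg => //.
have one : 1 < P by apply: one_lt.
by rewrite /upd /= e (modn_small one).
Qed.

Definition initial_env (v : nat) : nat :=
  match v with 0 => x | 1 => w | 2 => n.-1 | _ => 0 end.

Lemma agree_initial : agree (initial S x) initial_env.
Proof.
have nP : n.-1 < P by rewrite prednK ?card_S_gt0 // card_le_words.
move=> [|[|[|v]]] _ //=; first by rewrite modn_small // ltn_expl.
- by rewrite modn_small.
- by rewrite mod0n.
Qed.

Lemma K_maximal l : l <= w -> 0 < distance S x < 2 ^ (w - l) -> l <= K.
Proof.
move=> lw /andP[d0 dl]; set D := distance S x in d0 dl *.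
have : trunc_log 2 D < w - l.
  by rewrite -(ltn_exp2l _ _ (isT : 1 < 2)); apply: leq_ltn_trans (trunc_logP _ d0) dl.
lia.
Qed.

Lemma query_from :
  (rk x < n -> hp prepare initial_env (fun r =>
     ht (Seq search finish) r ((5 * search_step_cost + 132 * finish_cost) * KL.+1)
       (fun r => r 0 = (rk x + (P - 1)) %% P))) ->
  ht query initial_env (query_cost * KL.+1)
    (fun r => r 0 = (rk x + (P - 1)) %% P).
Proof.
move=> main; have n0 := card_S_gt0.
have le : cost (EB Ltn (ES vN) vX) + 1 + (max_time (asg 0 vN) + (max_time prepare +
  (5 * search_step_cost + 132 * finish_cost) * KL.+1)) <= query_cost * KL.+1.
  rewrite /query_cost.
  move: (cost _) (max_time _) (max_time _) search_step_cost finish_cost.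
  by move=> a b c d e; rewrite !mulnDl; nia.
apply: ht_if le _ _ => //; rewrite (@ev_ltn _ _ _ _ _ _ (A n.-1) x) //;
  rewrite array_lt_rank ?prednK //; case: ltnP => // cmp _.
- apply: (ht_le (leq_addr _ _)).
  apply: ht_hp => //; apply: hp_asg => //; rewrite /upd /=.
  have -> : rk x = n by apply/eqP; rewrite eqn_leq -[X in _ <= X]size_array rank_size; lia.
  have -> : n + (P - 1) = n.-1 + P by have := expn_gt0 2 w; lia.
  by rewrite modnDr modn_small // prednK // card_le_words.
- apply: (ht_le (leq_addl _ _)).
  apply: ht_seq (leqnn _) _; apply: ht_hp => //; apply: main.
  exact: cmp.
Qed.

Lemma computes_of_ht T : ht query initial_env T (fun r => r 0 = (rk x + (P - 1)) %% P) ->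
  exists2 t, computes S h B query x t (predecessor_answer S x) & t <= T.
Proof.
move=> /(_ _ agree_initial)[t [s [r [e le a q]]]].
exists t => //; exists s => //; apply: val_inj.
by rewrite /= predecessor_answerE -q a.
Qed.

End Query.

Section Plain.
Variables (w : nat) (S : {set word w}) (h : hash_family w).
Variable x : word w.
Hypotheses (w0 : 0 < w) (S0 : S != set0) (nu_small : size_log S < 128).

(* With an empty index the search degenerates to galloping from both ends of
   the array, which is fast when [S] has boundedly many elements. *)
Lemma query_plain : exists2 t,
  computes S h [::] query x t (predecessor_answer S x) &
  t <= query_cost * (trunc_log 2 (w - (trunc_log 2 (distance S x)).+1)).+1.
Proof.
apply: computes_of_ht => //; apply: query_from => // rn.
have n0 := card_S_gt0 S0.
have rd0 : read_index w [::] 0 = 0.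
  by rewrite /read_index big1 // => j _; rewrite nth_nil.
apply: hp_seq; apply: (@hp_set _ _ _ _ _ _ _ 0) => //=; first exact: mod0n.
apply: hp_seq; apply: (@hp_set _ _ _ _ _ _ _ #|S|.-1) => //.
apply: hp_if => // [|_].
  by rewrite /= mod0n rd0 mod0n.
apply: (@hp_set _ _ _ _ _ _ _ 0) => //=; first exact: mod0n.
set z := upd _ 5 0.
have bz : bracket S x z.
  by split; rewrite /z /upd //=; [rewrite -ltnS prednK|rewrite prednK].
apply: (@ht_le _ _ _ _ _ _ (1 * search_step_cost + finish_cost * 127.+4)).
  move: search_step_cost finish_cost => a b; nia.
apply: ht_seq (leqnn _) _.
(* Registers 23 and 24 are still 0, so the condition fails at once and the loop is never entered. *)
apply: (@ht_while _ S h [::] _ _ (fun k r => r = z)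
  (max_time search_body) _ _ _ _ 0) => //.
- move=> k r -> _; apply: finish_ok => //.
  rewrite geq_min; apply/orP; left; apply: leq_trans (leq_subr _ _) _.
  apply: leq_trans (ltnW rn) _; apply: leq_trans (ltnW (size_log_gt S)) _.
  by rewrite leq_exp2l.
- by move=> k r -> /=; rewrite ?ltn0 ?mod0n ?muln0 ?mod0n.
Qed.

End Plain.

Section Indexed.
Variables (w : nat) (S : {set word w}).
Hypothesis nu_big : 128 <= size_log S.
Local Notation n := #|S|.
Local Notation nu := (size_log S).

Lemma query_indexed : exists2 B : seq bool, size B <= 2052 * n &
  forall (h : hash_family w) (x : word w), exists2 t,
    computes S h B query x t (predecessor_answer S x) &
    t <= query_cost * (trunc_log 2 (w - (trunc_log 2 (distance S x)).+1)).+1.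
Proof.
have n0 := n_gt0 nu_big.
have [r [s [a0 [a1 [t [F [tab nut Ff]]]]]]] := exists_table nu_big.
have w127 : 127 <= w by have := nu_le_w nu_big; lia.
have w0 : 0 < w by lia.
have S0 : S != set0 by rewrite -card_gt0.
have nP : n <= 2 ^ w := card_le_words S.
(* Here [nu >= 128] exceeds twice the constant 51 of the table bound. *)
have tn : 2 * t <= n.
  have : 128 * t <= nu * t by rewrite leq_mul2r nu_big orbT.
  by lia.
have [[a0u a1r sr rL] _ _ _] := tab.
have nu5 : 5 <= nu by lia.
have nu2 : (2 * nu).+1 <= n.
  exact: leq_trans (double_lt_exp nu5) (exp_nu_le nu_big).
have Ln : max_length S <= n by apply: geq_minl.
have Lw : max_length S < w by have := geq_minr n w.-1; rewrite /max_length; lia.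
have fw : field_size S <= w by apply: geq_minl.
have fn : field_size S <= n by apply: leq_trans (geq_minr _ _) nu2.
have f0 : 0 < field_size S by rewrite leq_min w0.
have small k : k <= n.+1 -> k <= w -> k < 2 ^ n.+1 /\ k < 2 ^ w.
  by move=> kn kw; split; [apply: leq_ltn_trans kn _|apply: leq_ltn_trans kw _];
    apply: ltn_expl.
have nuw : nu <= w.+1 by have := nu_le_w nu_big; lia.
have Hlt i : header_fields S r s a0 a1 i < 2 ^ n.+1 /\
    header_fields S r s a0 a1 i < 2 ^ w.
  have le_exp k u : k < 2 ^ u -> u <= n.+1 -> u <= w -> k < 2 ^ n.+1 /\ k < 2 ^ w.
    by move=> ku un uw; split; apply: leq_trans ku _; rewrite leq_exp2l.
  case: i => [|[|[|[|[|[|[|[|[|i]]]]]]]]] /=; try by rewrite !expn_gt0.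
  - split; last by apply: leq_trans nP; lia.
    by apply: (@leq_ltn_trans n.+1); [lia|apply: ltn_expl].
  - by apply: small; lia.
  - by apply: small; lia.
  - by apply: small; lia.
  - by apply: le_exp a0u _ _; lia.
  - by apply: le_exp a1r _ _; lia.
  - by apply: small; lia.
have t_om : t <= 2 ^ n.+1.
  by apply: leq_trans (ltnW (ltn_expl n.+1 (isT : 1 < 2))); lia.
have t_w : t + 9 < 2 ^ w by lia.
have om2 : 2 <= n.+1 by lia.
have fw' : 0 < field_size S <= w by rewrite f0.
have [B [tau [rho [ob [hw [sB lay]]]]]] :=
  exists_layout om2 (isT : 1 < 9) fw' t_om t_w Hlt Ff.
exists B.
  (* The bound is 12 times the sum of [9 (n + 1) <= 18 n] and [(2 nu + 1) t <= 3 nu t <= 153 n], and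
     [12 * 171 = 2052]. *)
  apply: leq_trans sB _.
  have : field_size S * t <= (2 * nu).+1 * t by rewrite leq_mul2r geq_minr orbT.
  have : t <= nu * t by rewrite leq_pmull //; lia.
  by rewrite mulSn -mulnA; lia.
move=> h x; apply: computes_of_ht => //; apply: query_from => // rn.
have t_small : t <= n by lia.
have wP : w < 2 ^ w by apply: ltn_expl.
apply: hp_seq; apply: (@hp_set _ _ _ _ _ _ _ 0) => //=; first exact: mod0n.
apply: hp_seq; apply: (@hp_set _ _ _ _ _ _ _ n.-1) => //.
have [[rd0 _ _ _] _ _ _ _] := lay.
apply: hp_if => //= [_|e]; last by move: rd0; rewrite mod0n in e; rewrite e.
apply: hp_seq; apply: hp_conseq.
  exact: (@decode_ok w S h B x nu_big r s a0 a1 t F t_small _ _ _ _ lay).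
move=> r1 st1; apply: hp_conseq.
  exact: (@descend_ok w S h B x nu_big r s a0 a1 t F tab t_small _ _ _ _ lay r1 st1 rn).
move=> z [stz bz z23 z24 cases].
have Kmax := @K_maximal w S x w0 S0.
set K := w - (trunc_log 2 (distance S x)).+1 in Kmax *.
have m0L : nu./2 <= max_length S.
  by rewrite /max_length leq_min; apply/andP; split; have := odd_double_half nu; lia.
have dz : descent_state S x r s a0 a1 tau rho ob hw z.
  split=> //; case: cases => [e|str]; [by left|right].
  split; [by rewrite z23|by rewrite z23 leqnn|by rewrite z23 z24 ltnS m0L leqnn|by left].
apply: (@ht_le _ _ _ _ _ _ ((3 * trunc_log 2 K + 5) * search_step_cost +
    finish_cost * (3 * trunc_log 2 K + 5).+4)).
  move: (trunc_log 2 K) search_step_cost finish_cost => a b c.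
  nia.
apply: ht_seq (leqnn _) _.
have H := @search_ok w S h B x nu_big r s a0 a1 t F tab t_small _ _ _ _ lay K Kmax z dz z23.
apply: ht_post H _.
move=> r' [dr' fin]; apply: finish_ok => //; first by case: dr'.
exact: (@final_gap w S x nu_big r s a0 a1 t t_small _ _ _ _ K Kmax r' dr' fin).
Qed.

End Indexed.

Local Open Scope ring_scope.

(** * Truncated and real logarithms *)

Section Logarithm.
Variable R : realType.

Lemma ln2_gt0 : 0 < ln 2 :> R.
Proof. by apply: ln_gt0; rewrite ltr1n. Qed.

Lemma lg_ge1 (z : R) : 1 <= lg z.
Proof.
rewrite /lg; case: ltP => // z2.
rewrite ler_pdivlMr ?ln2_gt0 // mul1r ler_ln // posrE ?ltr0n //.
by apply: lt_le_trans z2; rewrite ltr0n.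
Qed.

Lemma trunc_log_le_lg (k : nat) (z : R) : (0 < k)%N -> k%:R <= z ->
  (trunc_log 2 k)%:R <= lg z.
Proof.
move=> k0 kz; have [k2|k2] := ltnP k 2.
  have -> : k = 1%N by case: k k0 k2 {kz} => [|[|]].
  by rewrite trunc_log1; apply: le_trans (lg_ge1 z); rewrite ler01.
have z2 : 2 <= z by apply: le_trans kz; rewrite ler_nat.
rewrite /lg ltNge z2 /= ler_pdivlMr ?ln2_gt0 // mulr_natl -lnXn ?ltr0n //.
rewrite ler_ln ?posrE ?exprn_gt0 ?ltr0n //; last exact: lt_le_trans z2.
by apply: le_trans kz; rewrite -natrX ler_nat trunc_logP.
Qed.

Lemma lg_le_trunc_log (d : nat) : lg (d%:R : R) <= (trunc_log 2 d).+1%:R.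
Proof.
rewrite /lg; case: ltP => [_|d2]; first by rewrite ler1n.
rewrite ler_pdivrMr ?ln2_gt0 // mulr_natl -lnXn ?ltr0n //.
rewrite ler_ln ?posrE ?exprn_gt0 ?ltr0n //; last first.
  by have := lt_le_trans (ltr0Sn R 1) d2; rewrite ltr0n.
by rewrite -natrX ler_nat ltnW // trunc_log_ltn.
Qed.

(** [lg d] is at most the truncated logarithm plus 1, so the natural number on the left is at most
    [w - lg d] unless truncated to 0. The convention that [lg] is at least 1 absorbs that case and
    the successor. *)
Lemma trunc_log_gap_le (w d : nat) : (0 < w)%N ->
  (trunc_log 2 (w - (trunc_log 2 d).+1)).+1%:R <= 2 * lg (w%:R - lg d%:R : R).
Proof.
move=> w0; rewrite -natr1 mulr_natl mulr2n.
apply: lerD; last exact: lg_ge1.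
have [k0|k0] := posnP (w - (trunc_log 2 d).+1)%N.
  by rewrite k0 trunc_log0; apply: le_trans (lg_ge1 _); rewrite ler01.
apply: trunc_log_le_lg => //.
rewrite natrB; last by rewrite ltnW // -subn_gt0.
by rewrite lerD2l lerN2 lg_le_trunc_log.
Qed.

End Logarithm.

Theorem theorem5 (R : realType) :
  exists p : program,
  forall delta : R, 0 < delta ->
  exists c : R,
  forall (w : nat) (S : {set word w}), (0 < w)%N -> S != set0 ->
  with_probability (1 - delta) (fun h : hash_family w =>
    exists B : seq bool,
      (size B)%:R <= c * (#|S|%:R * lg (w%:R : R)) /\
      forall x : word w,
        exists2 t : nat, computes S h B p x t (predecessor_answer S x)
          & t%:R <= c * lg (w%:R - lg ((distance S x)%:R : R))).
Proof.
exists query => delta delta0.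
exists (2052 + query_cost * 2)%N%:R => w S w0 S0.
exists setT.
  rewrite cardsT divff; last first.
    by rewrite pnatr_eq0 -lt0n; apply/card_gt0P; exists [ffun=> to_word w 0].
  by rewrite lerBlDr lerDl ltW.
move=> h _.
have [B sB qB] : exists2 B : seq bool, (size B <= 2052 * #|S|)%N &
    forall x : word w, exists2 t, computes S h B query x t (predecessor_answer S x) &
    (t <= query_cost * (trunc_log 2 (w - (trunc_log 2 (distance S x)).+1)).+1)%N.
  have [nu_small|nu_big] := ltnP (size_log S) 128.
    by exists [::] => // x; apply: query_plain.
  by have [B sB qB] := query_indexed nu_big; exists B.
move: query_cost qB => C qB; exists B; split.
  apply: (@le_trans _ _ (2052 * #|S|)%N%:R); first by rewrite ler_nat.
  rewrite natrM; apply: ler_pM; rewrite ?ler0n ?ler_nat ?leq_addr //.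
  by rewrite ler_peMr ?ler0n // lg_ge1.
move=> x; have [t ct le] := qB x; exists t => //.
apply: le_trans (_ : C%:R * (2 * lg (w%:R - lg ((distance S x)%:R : R))) <= _).
  apply: le_trans (_ : (C * (trunc_log 2 (w - (trunc_log 2
    (distance S x)).+1)).+1)%N%:R <= _); first by rewrite ler_nat.
  by rewrite natrM; apply: ler_wpM2l; rewrite ?ler0n // trunc_log_gap_le.
rewrite mulrA -natrM; apply: ler_wpM2r.
  by apply: le_trans (lg_ge1 _); rewrite ler01.
by rewrite ler_nat leq_addl.
Qed.
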